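(* Let $G$ be a finite group. Then every 2-maximal subgroup of $G$ is $\mathbb{P}$-subnormal in $G$ if and only if $\Phi(G^{\mathfrak{U}})=1$ and every proper subgroup of $G$ is supersolvable.
   Context: All groups are finite. A subgroup $K$ of a group $G$ is called 2-maximal in $G$ if $K$ is a maximal subgroup of some maximal subgroup $M$ of $G$. A subgroup $H$ of a group $G$ is called $\mathbb{P}$-subnormal in $G$ if either $H=G$ or there is a chain of subgroups $H=H_0\subset H_1\subset\ldots\subset H_n=G$ such that $|H_i:H_{i-1}|$ is a prime number for every $1\le i\le n$ (here $\mathbb{P}$ denotes the set of all prime numbers; no normality of $H_{i-1}$ in $H_i$ is required). $G^{\mathfrak{U}}$ denotes the smallest normal subgroup of $G$ such that the corresponding quotient group $G/G^{\mathfrak{U}}$ is supersolvable. $\Phi(X)$ denotes the Frattini subgroup of a group $X$ (with $\Phi(1)=1$). *)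

(* Defs.v *)
From mathcomp Require Import all_boot all_fingroup all_solvable.

Set Implicit Arguments.
Unset Strict Implicit.
Unset Printing Implicit Defensive.

Local Open Scope group_scope.

Definition two_maximal (gT : finGroupType) (K G : {group gT}) : bool :=
  [exists M : {group gT}, maximal K M && maximal M G].

(* connect r x y holds iff there is a finite r-chain from x to y; the chain   *)
(* of length 0 accounts for H = G.                                            *)
Definition P_subnormal (gT : finGroupType) (H G : {group gT}) : bool :=
  connect [rel A B : {group gT} | (A \subset B) && prime #|B : A|] H G.

Definition cyclic_normal_factor (gT : finGroupType) (G : {group gT}) :
    rel {group gT} :=
  [rel A B : {group gT} | [&& A <| G, B <| G, A \subset B & cyclic (B / A)]].

(* There is a series 1 = G_0 <= ... <= G_n = G of normal subgroups of G with  *)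
(* cyclic factors.                                                            *)
Definition supersolvable (gT : finGroupType) (G : {group gT}) : bool :=
  connect (cyclic_normal_factor G) 1%G G.

(* supersolvable_residual_min shows that this intersection is the smallest    *)
(* normal subgroup with supersolvable quotient.                               *)
Definition supersolvable_residual (gT : finGroupType) (G : {group gT}) :
    {group gT} :=
  (\bigcap_(N : {group gT} | (N <| G) && supersolvable (G / N)) N)%G.

Section Residual.

Variable gT : finGroupType.
Implicit Types G M N : {group gT}.

Lemma connect_map (T T' : finType) (e : rel T) (e' : rel T') (f : T -> T') :
    (forall x y, e x y -> e' (f x) (f y)) ->
  forall x y, connect e x y -> connect e' (f x) (f y).
Proof.
move=> fe x _ /connectP[s + ->]; elim: s x => //= y s IHs x /andP[exy es].
exact: connect_trans (connect1 (fe _ _ exy)) (IHs _ es).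
Qed.

Lemma supersolvable_quotientE G N : N <| G ->
  supersolvable (G / N) = connect (cyclic_normal_factor G) N G.
Proof.
move=> nsNG; apply/idP/idP => [ssGN | cNG].
  pose f (K : {group coset_of N}) := (coset N @*^-1 K)%G.
  have -> : N = f 1%G by apply/val_inj; rewrite /= -kerE ker_coset.
  have {2}-> : G = f (G / N)%G by apply/val_inj; rewrite /= quotientGK.
  apply: connect_map ssGN => A B /and4P[nA nB sAB cAB].
  have nf (K : {group coset_of N}) : K <| (G / N)%G -> f K <| G.
    by rewrite -(cosetpre_normal K) quotientGK.
  have sNfA : N \subset f A := sub_cosetpre A.
  apply/and4P; split; [exact: nf | exact: nf | exact: morphpreS |].
  have nfAB : f A <| f B by rewrite cosetpre_normal (normalS sAB (normal_sub nB) nA).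
  have nNfB : N <| f B.
    exact: normalS (sub_cosetpre B) (normal_sub (nf _ nB)) nsNG.
  by rewrite -(isog_cyclic (third_isog sNfA nNfB nfAB)) /= !cosetpreK.
rewrite /supersolvable.
have -> : [1 coset_of N]%G = (N / N)%G
  by apply/val_inj; rewrite /= trivg_quotient.
apply: (connect_map (f := fun X => (X / N)%G)) cNG => A B /and4P[nA nB sAB cAB].
have nsAB : A <| B by rewrite (normalS sAB (normal_sub nB) nA).
have sBN : B \subset 'N(N) by apply: subset_trans (normal_sub nB) (normal_norm nsNG).
apply/and4P; split; [exact: quotient_normal | exact: quotient_normal |
                     exact: quotientS |].
pose h := quotm_morphism (restrm_morphism sBN (coset_morphism N)) nsAB.
have := morphim_cyclic h cAB.
by rewrite /= morphim_quotm !morphim_restrm setIid (setIidPr sAB).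
Qed.

Lemma supersolvable_quotientI G M N : M <| G -> N <| G ->
  supersolvable (G / M) -> supersolvable (G / N) ->
  supersolvable (G / (M :&: N)%G).
Proof.
move=> nM nN; rewrite !supersolvable_quotientE ?normalI // => cM cN.
apply: connect_trans cM.
have {2}-> : M = (M :&: G)%G by apply/val_inj/esym/setIidPl/normal_sub.
apply: (connect_map (f := fun X => (M :&: X)%G)) cN => A B /and4P[nA nB sAB cAB].
apply/and4P; split; [exact: normalI | exact: normalI | exact: setIS | move=> /=].
have -> : M :&: A = A :&: (M :&: B)
  by rewrite setICA (setIidPl sAB).
have nAMB : M :&: B \subset 'N(A).
  exact: subset_trans (subsetIr _ _) (subset_trans (normal_sub nB) (normal_norm nA)).
rewrite (isog_cyclic (second_isog nAMB)).
exact: cyclicS (quotientS _ (subsetIr _ _)) cAB.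
Qed.

Lemma supersolvable_residual_min G :
  [/\ supersolvable_residual G <| G,
      supersolvable (G / supersolvable_residual G) &
      forall N, N <| G -> supersolvable (G / N) ->
        supersolvable_residual G \subset N].
Proof.
pose P (N : {group gT}) := (N <| G) && supersolvable (G / N).
have PG : P G.
  by rewrite /P normal_refl supersolvable_quotientE ?normal_refl // connect0.
have PI M N : P M -> P N -> P (M :&: N)%G.
  move=> /andP[nM sM] /andP[nN sN].
  by rewrite /P normalI // supersolvable_quotientI.
have [U /mingroupP[PU minU] _] := mingroup_exists PG.
have leU N : P N -> U \subset N.
  move=> PN; apply/setIidPl.
  exact: minU (PI _ _ PU PN) (subsetIl _ _).
have -> : supersolvable_residual G = U.
  apply/val_inj/eqP; rewrite /= eqEsubset bigcap_inf //=.
  exact/bigcapsP.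
by case/andP: PU => nU sU; split=> // N nN sN; apply/leU/andP.
Qed.

End Residual.

(* Main.v *)
Require Import Defs.
From mathcomp Require Import all_boot all_fingroup all_algebra all_solvable.
From mathcomp Require Import finfield mxrepresentation mxabelem.

Set Implicit Arguments.
Unset Strict Implicit.
Unset Printing Implicit Defensive.

Local Open Scope group_scope.

(** Call G minimal if all its proper subgroups are supersolvable, and let R be
    its supersolvable residual. Two classical theorems carry the proof: a
    solvable group whose maximal subgroups all have prime index is supersolvable
    (Huppert_supersolvable), and a minimal group is solvable
    (proper_supersolvable_sol, by the fusion argument of Frobenius for the least
    prime divisor of |G|).

    If G is minimal but not supersolvable, it has a maximal subgroup M of
    nonprime index. Then the core of M is Phi(G), and R is a normal Sylow
    p-subgroup of G with R M = G (residual_Sylow, nonprime_residual_mul).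

    Assume moreover that Phi(R) = 1, and let K be maximal in M. As R is abelian,
    the intersection of R and M is normal in G, so it lies in Phi(G); but it is
    complemented in G by the theorem of Gaschuetz, so it is trivial. Hence K R
    has the prime index |M : K| in G, and as K R is supersolvable, K is
    P-subnormal in it. For a maximal subgroup M of prime index, K is P-subnormal
    because |M : K| is prime.

    Conversely, assume that the 2-maximal subgroups of G are P-subnormal. Then
    G is solvable: the main tool is that a P-subnormal subgroup that contains
    one Sylow subgroup for the largest prime divisor of |G| contains all of them
    (P_subnormal_Sylow_sub, two_maximal_P_subnormal_sol). In a solvable group
    P-subnormality of K passes to M and shows that |M : K| is prime, so M is
    supersolvable by Huppert's criterion. If Phi(R) <> 1, then M is not a
    p'-group, so some K contains a Hall p'-subgroup of M; the last step A < G
    of the chain of K then has A above R, so that |G : A| is both prime to p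
    and a power of p. *)

(** * Supersolvable groups *)

Section Supersolvable.

Variable gT : finGroupType.
Implicit Types A B E G H K M N P : {group gT}.

Lemma supersolvable1 : supersolvable [1 gT].
Proof. exact: connect0. Qed.

Lemma supersolvableS G H : H \subset G -> supersolvable G -> supersolvable H.
Proof.
move=> sHG; rewrite /supersolvable => ssG.
suff: connect (cyclic_normal_factor H) (H :&: 1)%G (H :&: G)%G.
  have -> : (H :&: 1)%G = 1%G by apply: val_inj; rewrite /= setIg1.
  by have -> : (H :&: G)%G = H by apply/val_inj; rewrite /= (setIidPl sHG).
apply: (connect_map (f := fun X => (H :&: X)%G)) ssG => A B.
case/and4P=> nsAG nsBG sAB cAB.
apply/and4P; split=> /=; rewrite ?(normalGI sHG) ?setIS //=.
have -> : H :&: A = A :&: (H :&: B) by rewrite setICA (setIidPl sAB).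
have nAHB : H :&: B \subset 'N(A).
  by rewrite subIset // (subset_trans sHG (normal_norm nsAG)).
rewrite (isog_cyclic (second_isog nAHB)).
exact: cyclicS (quotientS _ (subsetIr _ _)) cAB.
Qed.

Lemma morphim_supersolvable (rT : finGroupType) (D : {group gT})
    (f : {morphism D >-> rT}) G :
  G \subset D -> supersolvable G -> supersolvable (f @* G).
Proof.
move=> sGD; rewrite /supersolvable => ssG.
have -> : 1%G = (f @* 1)%G by apply/val_inj; rewrite /= morphim1.
apply: (connect_map (f := fun X => (f @* X)%G)) ssG => A B.
case/and4P=> nsAG nsBG sAB cAB.
have nsAB : A <| B by rewrite (normalS sAB (normal_sub nsBG) nsAG).
have sBD := subset_trans (normal_sub nsBG) sGD.
apply/and4P; split=> /=; rewrite ?morphim_normal ?morphimS //.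
have := morphim_cyclic (quotm_morphism (restrm_morphism sBD f) nsAB) cAB.
by rewrite /= morphim_quotm !morphim_restrm setIid (setIidPr sAB).
Qed.

Lemma quotient_supersolvable G N :
  N <| G -> supersolvable G -> supersolvable (G / N).
Proof. by move/normal_norm; apply: morphim_supersolvable. Qed.

Lemma supersolvable_cyclic_ext G N :
  N <| G -> cyclic N -> supersolvable (G / N) -> supersolvable G.
Proof.
move=> nsNG cN; rewrite supersolvable_quotientE // => /(connect_trans _); apply.
apply/connect1/and4P; split; rewrite ?normal1 ?sub1G //.
by rewrite -(isog_cyclic (quotient1_isog N)).
Qed.

(** Intersecting E with a normal series with cyclic factors, the first
    nontrivial intersection embeds in a factor, so it is cyclic and its
    subgroups are characteristic. *)
Lemma supersolvable_prime_normal G E :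
    supersolvable G -> E <| G -> E :!=: 1 ->
  exists N : {group gT}, [/\ N <| G, N \subset E & prime #|N|].
Proof.
move=> ssG nsEG ntE; pose tI A := A :&: E == 1.
have: tI 1%G by rewrite /tI /= (setIidPl (sub1G E)).
have ntIG : ~~ tI G by rewrite /tI setIC (setIidPl (normal_sub nsEG)).
have [s] := connectP ssG; elim: s 1%G => [|B s IHs] A0 /=.
  by move=> _ <- tIG; rewrite tIG in ntIG.
move=> /andP[/and4P[nsAG nsBG sAB cAB] BsG] lastG /eqP tiAE.
have [tiBE | ntBE] := boolP (tI B); first exact: IHs BsG lastG tiBE.
have cBE : cyclic (B :&: E).
  have nABE : B :&: E \subset 'N(A0).
    exact: subset_trans (subsetIl _ _)
      (subset_trans (normal_sub nsBG) (normal_norm nsAG)).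
  have tiA : A0 :&: (B :&: E) = 1 by rewrite setICA tiAE setIg1.
  rewrite (isog_cyclic (quotient_isog nABE tiA)).
  exact: cyclicS (quotientS _ (subsetIl _ _)) cAB.
have [p p_pr pBE] : exists2 p, prime p & p %| #|B :&: E|.
  by have [tiBE | //] := trivgVpdiv (B :&: E)%G; rewrite /tI tiBE eqxx in ntBE.
have [x xBE ox] := Cauchy p_pr pBE.
have sxBE : <[x]> \subset B :&: E by rewrite cycle_subG.
exists <[x]>%G; split; last by rewrite -orderE ox.
  apply: char_normal_trans (normalI nsBG nsEG).
  by rewrite (sub_cyclic_char _ cBE).
exact: subset_trans sxBE (subsetIr _ _).
Qed.

(** * P-subnormality and maximal subgroups *)

Lemma P_subnormal_refl G : P_subnormal G G.
Proof. exact: connect0. Qed.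

Lemma P_subnormal_trans K H G :
  P_subnormal K H -> P_subnormal H G -> P_subnormal K G.
Proof. exact: connect_trans. Qed.

Lemma prime_index_P_subnormal H G :
  H \subset G -> prime #|G : H| -> P_subnormal H G.
Proof. by move=> sHG pr_GH; apply: connect1; rewrite /= sHG. Qed.

Lemma P_subnormal_ind H (Q : {group gT} -> Prop) :
    Q H ->
    (forall A B, P_subnormal H A -> Q A -> A \subset B -> prime #|B : A| ->
       Q B) ->
  forall G, P_subnormal H G -> Q G.
Proof.
move=> QH Qstep G /connectP[s]; elim/last_ind: s G => [|s B IHs] G /=.
  by move=> _ ->.
rewrite rcons_path last_rcons => /andP[Hs /andP[sAB prAB]] ->.
apply: Qstep sAB prAB; last exact: IHs Hs _.
by apply/connectP; exists s.
Qed.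

Lemma P_subnormal_sub H G : P_subnormal H G -> H \subset G.
Proof.
by elim/P_subnormal_ind=> // A B _ sHA sAB _; apply: subset_trans sAB.
Qed.

Lemma P_subnormal_last H G : P_subnormal H G -> H :!=: G ->
  exists A : {group gT}, [/\ P_subnormal H A, A \subset G & prime #|G : A|].
Proof.
pose Q (B : {group gT}) := H :!=: B ->
  exists A : {group gT}, [/\ P_subnormal H A, A \subset B & prime #|B : A|].
apply: (P_subnormal_ind (Q := Q)); rewrite /Q ?eqxx // => A B PA _ sAB prAB _.
by exists A.
Qed.

Lemma maximal_eq_or G M H :
  maximal M G -> M \subset H -> H \subset G -> H = M \/ H = G.
Proof.
move=> maxM sMH sHG.
have [_ /(_ H sMH sHG)] := maximal_eqP _ _ (introT orP (or_intror maxM)).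
by case=> /group_inj; [left | right].
Qed.

Lemma maximal_normal_mul G M N :
  maximal M G -> N <| G -> ~~ (N \subset M) -> N * M = G.
Proof.
move=> maxM /andP[sNG nNG] not_sNM.
have sMG := proper_sub (maxgroupp maxM).
rewrite -norm_joinEr ?(subset_trans sMG) //.
have sMj : M \subset N <*> M := joing_subr _ _.
have sNM_G : N <*> M \subset G by rewrite join_subG sNG.
have [defM | defM] := maximal_eq_or maxM sMj sNM_G; last first.
  exact: (congr1 (@gval gT) defM).
by case/negP: not_sNM; rewrite -defM joing_subl.
Qed.

End Supersolvable.

Lemma isog_supersolvable (gT rT : finGroupType)
    (G : {group gT}) (H : {group rT}) :
  G \isog H -> supersolvable G -> supersolvable H.
Proof.
case/isogP=> f _ defH ssG; rewrite -(group_inj defH).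
exact: morphim_supersolvable.
Qed.

Lemma supersolvable_sol (gT : finGroupType) (G : {group gT}) :
  supersolvable G -> solvable G.
Proof.
have [n] := ubnP #|G|; elim: n => // n IHn in gT G * => /ltnSE-leGn ssG.
have [-> | ntG] := eqVneq (G : {set gT}) 1; first exact: solvable1.
have [N [nsNG _ prN]] := supersolvable_prime_normal ssG (normal_refl G) ntG.
rewrite (series_sol nsNG) (abelian_sol (cyclic_abelian (prime_cyclic prN))).
apply: IHn (quotient_supersolvable nsNG ssG); apply: leq_trans leGn.
by rewrite ltn_quotient ?normal_sub // -cardG_gt1 prime_gt1.
Qed.

(** If the maximal subgroup M avoids a normal subgroup N of prime order, then
    N is a complement of M and the index of M is the order of N. *)
Lemma supersolvable_maximal_index (gT : finGroupType) (G M : {group gT}) :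
  supersolvable G -> maximal M G -> prime #|G : M|.
Proof.
have [n] := ubnP #|G|; elim: n => // n IHn in gT G M * => /ltnSE-leGn ssG maxM.
have /properP[sMG [x Gx notMx]] := maxgroupp maxM.
have ntG : G :!=: 1.
  by apply: contraNneq notMx => G1; move: Gx; rewrite G1 => /set1P->.
have [N [nsNG sNG prN]] := supersolvable_prime_normal ssG (normal_refl G) ntG.
have [sNM | not_sNM] := boolP (N \subset M).
  have nsNM : N <| M := normalS sNM sMG nsNG.
  have <- : #|G / N : M / N| = #|G : M|.
    by rewrite index_quotient_eq ?normal_norm // subIset // sNM orbT.
  apply: IHn; rewrite ?quotient_supersolvable ?quotient_maximal //.
  by apply: leq_trans leGn; rewrite ltn_quotient // -cardG_gt1 prime_gt1.
have tiNM : N :&: M = 1 by apply: contraNeq not_sNM; apply: prime_meetG.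
rewrite -divgS // -(maximal_normal_mul maxM nsNG not_sNM) TI_cardMg //.
by rewrite mulnK.
Qed.

Lemma supersolvable_P_subnormal (gT : finGroupType) (G H : {group gT}) :
  supersolvable G -> H \subset G -> P_subnormal H G.
Proof.
have [n] := ubnP #|G|; elim: n => // n IHn in G * => /ltnSE-leGn ssG sHG.
have [/group_inj-> | [M maxM sHM]] := maximal_exists sHG.
  exact: P_subnormal_refl.
have /andP[sMG _] := maxgroupp maxM.
have prGM := supersolvable_maximal_index ssG maxM.
apply: P_subnormal_trans (prime_index_P_subnormal sMG prGM).
apply: IHn (supersolvableS sMG ssG) sHM; apply: leq_trans leGn.
exact: proper_card (maxgroupp maxM).
Qed.

Lemma supersolvable_residual_eq1 (gT : finGroupType) (G : {group gT}) :
  supersolvable G -> supersolvable_residual G :=: 1.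
Proof.
move=> ssG; have [_ _ minR] := supersolvable_residual_min G.
by apply/trivgP; rewrite (minR 1%G) ?normal1 // quotient_supersolvable ?normal1.
Qed.

(** * Sylow subgroups for the largest prime divisor *)

Section LargestPrime.

Variables (gT : finGroupType) (p : nat).
Hypothesis p_pr : prime p.
Implicit Types A B G K M P Q : {group gT}.

(** Since A contains P, the prime |B : A| is not p, so it is less than p. The
    index of Q :&: A in Q is a power of p that is at most |B : A|. *)
Lemma prime_index_Sylow_sub A B P Q :
    {in \pi(B), forall r, r <= p} -> A \subset B -> prime #|B : A| ->
    p.-Sylow(B) P -> P \subset A -> p.-Sylow(B) Q ->
  Q \subset A.
Proof.
move=> le_p sAB prAB sylP sPA sylQ; rewrite -indexg_eq1.
have ltBAp : #|B : A| < p.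
  have BA_dv : #|B : A| %| #|B| := dvdn_indexg _ _.
  rewrite ltn_neqAle le_p ?mem_primes ?prAB ?cardG_gt0 // andbT.
  have p'BA : p^'.-nat #|B : A|.
    by apply: pnat_dvd (indexgS _ sPA) _; case/and3P: sylP.
  by apply: contraTneq p'BA => ->; rewrite pnatE // inE /= inE eqxx.
have leQA : #|Q : A| <= #|B : A|.
  exact: subset_leq_card (imsetS _ (pHall_sub sylQ)).
have /p_natP[[|k] QAp] : p.-nat #|Q : A|.
- exact: pnat_dvd (dvdn_indexg _ _) (pHall_pgroup sylQ).
- by rewrite QAp.
move: (leq_ltn_trans leQA ltBAp); rewrite QAp.
by rewrite ltnNge expnS leq_pmulr // expn_gt0 prime_gt0.
Qed.

(** All the Sylow p-subgroups of G lie in every term of the chain from K to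
    G. *)
Lemma P_subnormal_Sylow_sub K G P Q :
    {in \pi(G), forall r, r <= p} -> P_subnormal K G ->
    p.-Sylow(G) P -> P \subset K -> p.-Sylow(G) Q ->
  Q \subset K.
Proof.
move=> le_p PK + sPK; move: Q le_p; move: G PK.
apply: P_subnormal_ind => [Q _ _ /pHall_sub //|].
move=> A B PA IHA sAB prAB Q le_p sylP sylQ.
have sPA : P \subset A := subset_trans sPK (P_subnormal_sub PA).
have sQA : Q \subset A by apply: prime_index_Sylow_sub sylP sPA sylQ.
apply: IHA (pHall_subl sPA sAB sylP) (pHall_subl sQA sAB sylQ).
by move=> r /(piSg sAB); apply: le_p.
Qed.

(** The Frattini argument: P and P :^ g are conjugate in M for g in G. *)
Lemma Sylow_sub_Frattini G M P :
    M \subset G -> p.-Sylow(G) P -> 'N_G(P) \subset M ->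
    (forall Q, p.-Sylow(G) Q -> Q \subset M) ->
  M :=: G.
Proof.
move=> sMG sylP sNM sylM; apply/eqP; rewrite eqEsubset sMG.
have sylPM := pHall_subl (sylM P sylP) sMG sylP.
apply/subsetP=> g Gg; have sylPg : p.-Sylow(G) (P :^ g) by rewrite pHallJ.
have [x Mx defPg] := Sylow_trans sylPM (pHall_subl (sylM _ sylPg) sMG sylPg).
have /= defPg' : P :^ g = P :^ x := defPg.
rewrite -(mulgKV x g) groupM // (subsetP sNM) // inE.
rewrite groupM ?groupV // ?(subsetP sMG) //=.
by apply/normP; rewrite conjsgM defPg' conjsgK.
Qed.

(** Otherwise a maximal subgroup above 'N_G(P) would contain all the Sylow
    p-subgroups of G. *)
Lemma prime_index_Sylow_normal G P :
    {in \pi(G), forall r, r <= p} ->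
    (forall M, maximal M G -> prime #|G : M|) -> p.-Sylow(G) P ->
  P <| G.
Proof.
move=> le_p prM sylP; rewrite /normal (pHall_sub sylP) /=.
have [/setIidPl // | [M maxM sNM]] := maximal_exists (subsetIl G 'N(P)).
have /andP[sMG /negP[]] := maxgroupp maxM.
have sPM : P \subset M.
  by apply: subset_trans sNM; rewrite subsetI (pHall_sub sylP) normG.
rewrite (Sylow_sub_Frattini sMG sylP sNM) // => Q sylQ.
exact: prime_index_Sylow_sub le_p sMG (prM M maxM) sylP sPM sylQ.
Qed.

End LargestPrime.

Lemma pi_leq_max_pdiv (gT : finGroupType) (G : {group gT}) :
  {in \pi(G), forall r, r <= max_pdiv #|G|}.
Proof. by move=> r; apply: max_pdiv_max. Qed.

Lemma supersolvable_Sylow_normal (gT : finGroupType) p (G P : {group gT}) :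
    prime p -> {in \pi(G), forall r, r <= p} -> supersolvable G ->
  p.-Sylow(G) P -> P <| G.
Proof.
move=> p_pr le_p ssG; apply: prime_index_Sylow_normal => // M.
exact: supersolvable_maximal_index.
Qed.

(** Factoring out the normal Sylow subgroup for the largest prime divisor, as
    long as it is not p, leaves a p-group. *)
Lemma supersolvable_p_nilpotent (gT : finGroupType) p (G : {group gT}) :
    {in \pi(G), forall r, p <= r} -> supersolvable G ->
  p^'.-Hall(G) 'O_p^'(G).
Proof.
have [n] := ubnP #|G|; elim: n => // n IHn in gT G * => /ltnSE-leGn ge_p ssG.
have [pG | not_pG] := boolP (p.-group G).
  rewrite /pHall pcore_sub pcore_pgroup pnatNK.
  exact: pnat_dvd (dvdn_indexg _ _) pG.
pose q := max_pdiv #|G|; have le_q : {in \pi(G), _} := @pi_leq_max_pdiv gT G.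
have ntG : #|G| > 1.
  by rewrite cardG_gt1; apply: contraNneq not_pG => ->; apply: pgroup1.
have q_pr : prime q by rewrite max_pdiv_prime.
have p'q : q \in p^'.
  apply: contraNN not_pG => /eqP q_p; apply/pgroupP=> r r_pr rG.
  have piGr : r \in \pi(G) by rewrite mem_primes r_pr cardG_gt0.
  by rewrite inE /= eqn_leq -{1}q_p le_q ?ge_p.
have [Q sylQ] := Sylow_exists q G.
have nsQG := supersolvable_Sylow_normal q_pr le_q ssG sylQ.
have p'Q : p^'.-group Q.
  by apply: sub_in_pnat (pHall_pgroup sylQ) => r _ /eqnP->.
have ntQ : Q :!=: 1.
  by rewrite -rank_gt0 (rank_Sylow sylQ) p_rank_gt0 pi_max_pdiv.
have /and3P[_ p'O pO] : p^'.-Hall(G / Q) 'O_p^'(G / Q).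
  apply: IHn (quotient_supersolvable nsQG ssG) => [|r piGr].
    by apply: leq_trans leGn; rewrite ltn_quotient ?normal_sub.
  by rewrite ge_p // (pi_of_dvd (dvdn_quotient _ _) _ piGr).
pose K := (coset Q @*^-1 'O_p^'(G / Q))%G.
have nsKG : K <| G.
  by rewrite -(quotientGK nsQG) cosetpre_normal pcore_normal.
have p'K : p^'.-group K.
  by rewrite /pgroup card_cosetpre pnatM; apply/andP.
rewrite /pHall pcore_sub pcore_pgroup.
apply: pnat_dvd (indexgS G (pcore_max p'K nsKG)) _.
by rewrite -[G in #|G : _|](quotientGK nsQG) /= index_cosetpre.
Qed.

(** * Fusion in groups with p-nilpotent local subgroups *)

Section Fusion.

Variables (gT : finGroupType) (p : nat) (G : {group gT}).
Implicit Types P S T : {group gT}.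

(** The transfer of x in P to P / P^`(1) is a product of conjugates of powers
    of x, whose exponents add up to |G : P|. These conjugates lie in P, so
    they are P-conjugate to these powers, and the transfer is the class of
    x ^+ #|G : P|. It is trivial when x is in G^`(1). *)
Lemma transfer_focal P :
    p.-Sylow(G) P ->
    (forall x g, x \in P -> g \in G -> x ^ g \in P ->
       exists2 y, y \in P & x ^ g = x ^ y) ->
  P :&: G^`(1) \subset P^`(1).
Proof.
move=> sylP controlP; have [sPG pP p'GP] := and3P sylP.
have nP'P : P \subset 'N(P^`(1)) := der_norm 1 P.
pose alpha := restrm_morphism nP'P (coset_morphism P^`(1)).
have abA : abelian (alpha @* P).
  by rewrite /= morphim_restrm setIid -quotientE der_abelian.
apply/subsetP=> x /setIP[Px G'x]; have Gx := subsetP sPG x Px.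
have V0 : transfer G abA x = 0%R.
  pose V := @transfer_morphism _ _ G P alpha abA.
  have /derG1P VG'1 : abelian (V @* G).
    by apply/centsP=> u _ v _; apply: GRing.addrC.
  by have := mem_morphim V Gx G'x; rewrite morphim_der // VG'1 => /set1P.
have trX := transversalP (rcosets_cycle_partition sPG Gx).
have XG y : y \in transversal (rcosets P G :* <[x]>) G -> y \in G.
  by apply: subsetP; apply: transversal_sub trX.
have := transfer_cycle_expansion sPG abA Gx trX; rewrite {}V0.
rewrite (eq_bigr (fun y => FiniteModule.fmod abA (alpha x)
                             *+ #|<[x]> : P :* y|)%R) => [|y Xy]; last first.
  set n := #|_ : _|.
  have Pxny : (x ^+ n) ^ y^-1 \in P.
    by rewrite conjgE invgK mulgA -mem_rcoset mulg_exp_card_rcosets.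
  have Gy : y^-1 \in G by rewrite groupV XG.
  have [z Pz ->] := controlP _ _ (groupX n Px) Gy Pxny.
  rewrite /restrm /= -FiniteModule.fmodX ?mem_morphim //.
  rewrite -morphX //= morphJ ?groupX //=.
  congr (FiniteModule.fmod abA _); rewrite conjgE.
  have memA u : u \in P -> restrm nP'P (coset P^`(1)) u \in alpha @* P.
    by move=> Pu; apply: (mem_morphim alpha).
  by rewrite (centsP abA _ (memA _ (groupX n Px)) _ (memA _ Pz)) mulKg.
rewrite GRing.sumrMnr (sum_index_rcosets_cycle sPG Gx trX).
rewrite -FiniteModule.fmodX ?mem_morphim // -morphX // => /esym xm0.
have xm1 : alpha (x ^+ #|G : P|) = 1.
  by have := congr1 val xm0; rewrite FiniteModule.fmodK ?mem_morphim ?groupX.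
have P'xm : x ^+ #|G : P| \in P^`(1).
  by rewrite coset_idr // (subsetP nP'P) ?groupX.
have coPm : coprime #|P| #|G : P| := pnat_coprime pP p'GP.
by rewrite -(expgK coPm Px) groupX.
Qed.

Definition p_local_nilpotent := forall D : {group gT},
  D \subset G -> p.-group D -> D :!=: 1 -> p^'.-Hall('N_G(D)) 'O_p^'('N_G(D)).

Hypothesis nilG : p_local_nilpotent.

(** Descending induction on the order of D = S :&: T. Sylow
    p-subgroups S0 and T0 of the normaliser N of D that contain 'N_S(D) and
    'N_T(D) are conjugate under 'O_p^'(N), which centralises D, and they lie in
    Sylow subgroups S1 and T1 of G. The intersections of S with S1, of a
    conjugate of S1 with T1, and of T1 with T all properly contain D. *)
Lemma Sylow_conj_cent S T :
    p.-Sylow(G) S -> p.-Sylow(G) T ->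
  exists2 c, c \in 'C_G(S :&: T) & T :=: S :^ c.
Proof.
have [n] := ubnP (#|G| - #|S :&: T|).
elim: n => // n IHn in S T * => /ltnSE-len sylS sylT.
have [sSG pS _] := and3P sylS; have [sTG pT _] := and3P sylT.
have [defT | neqST] := eqVneq (S : {set gT}) T.
  by exists 1; rewrite ?group1 // conjsg1.
pose D := (S :&: T)%G; have pD : p.-group D := pgroupS (subsetIl S T) pS.
have [D1 | ntD] := eqVneq (D : {set gT}) 1.
  have [x Gx defT] := Sylow_trans sylS sylT.
  by exists x; rewrite // (_ : S :&: T = 1) // cent1T setIT.
pose N := 'N_G(D)%G; have sNG : N \subset G := subsetIl _ _.
have ltDS : D \proper S.
  rewrite properEneq subsetIl andbT; apply: contraNneq neqST => /setIidPl sST.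
  by rewrite eqEcard sST (card_Hall sylS) (card_Hall sylT) /=.
have ltDT : D \proper T.
  rewrite properEneq subsetIr andbT; apply: contraNneq neqST => /setIidPr sTS.
  by rewrite eq_sym eqEcard sTS (card_Hall sylS) (card_Hall sylT) /=.
have local_Sylow (U : {group gT}) : p.-Sylow(G) U -> D \proper U ->
  exists U0 : {group gT}, exists U1 : {group gT},
    [/\ p.-Sylow(N) U0, p.-Sylow(G) U1, U0 \subset U1,
        D \proper U0 & #|D| < #|U :&: U1|].
  move=> sylU ltDU; have [sUG pU _] := and3P sylU.
  have ltDN := nilpotent_proper_norm (pgroup_nil pU) ltDU.
  have pNU : p.-group 'N_U(D) := pgroupS (subsetIl _ _) pU.
  have [U0 sylU0 sNU0] := Sylow_superset (setSI 'N(D) sUG) pNU.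
  have sU0G := subset_trans (pHall_sub sylU0) sNG.
  have [U1 sylU1 sU01] := Sylow_superset sU0G (pHall_pgroup sylU0).
  exists U0, U1; split=> //; first exact: proper_sub_trans ltDN sNU0.
  apply: leq_trans (proper_card ltDN) (subset_leq_card _).
  by rewrite subsetI subsetIl (subset_trans sNU0).
have step (U V : {group gT}) : p.-Sylow(G) U -> p.-Sylow(G) V ->
    D \subset U :&: V -> #|D| < #|U :&: V| ->
  exists2 c, c \in 'C_G(D) & V :=: U :^ c.
  move=> sylU sylV sDUV ltDUV.
  have [|c cUV ->] := IHn U V _ sylU sylV.
    apply: leq_trans len; apply: ltn_sub2l => //.
    apply: leq_trans ltDUV (subset_leq_card _).
    by rewrite subIset // (pHall_sub sylU).
  by exists c => //; apply: subsetP cUV; rewrite setIS ?centS.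
have [S0 [S1 [sylS0 sylS1 sS01 ltDS0 ltDS1]]] := local_Sylow S sylS ltDS.
have [T0 [T1 [sylT0 sylT1 sT01 ltDT0 ltDT1]]] := local_Sylow T sylT ltDT.
have [||a cDa defS1] := step S S1 sylS sylS1 => //.
  by rewrite subsetI subsetIl (subset_trans (proper_sub ltDS0)).
have [||b cDb defT1] := step T T1 sylT sylT1 => //.
  by rewrite subsetI subsetIr (subset_trans (proper_sub ltDT0)).
have nsDN : D <| N by rewrite normal_subnorm subIset // sSG.
have sDG : D \subset G by rewrite subIset ?sSG.
have /sdprodP[_ mulOS0 _ _] : 'O_p^'(N) ><| S0 = N.
  exact/sdprod_p'core_HallP/nilG.
have [o Oo defT0] : exists2 o, o \in 'O_p^'(N) & T0 :=: S0 :^ o.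
  have [x Nx ->] := Sylow_trans sylS0 sylT0.
  have /mulsgP[s o S0s Oo ->] : x \in S0 * 'O_p^'(N).
    by rewrite normC ?mulOS0 // (subset_trans (pHall_sub sylS0)) ?gFnorm.
  by exists o; rewrite // conjsgM (conjGid S0s).
have cDo : o \in 'C_G(D).
  rewrite inE (subsetP sNG) ?(subsetP (pcore_sub _ _) _ Oo) //=.
  have: 'O_p^'(N) \subset 'C(D).
    rewrite centsC; apply/commG1P/trivgP.
    rewrite -(coprime_TIg (pnat_coprime pD (pcore_pgroup p^' N))).
    have nOD : D \subset 'N('O_p^'(N)).
      exact: subset_trans (normal_sub nsDN) (gFnorm _ _).
    have nDO : 'O_p^'(N) \subset 'N(D).
      exact: subset_trans (pcore_sub _ _) (normal_norm nsDN).
    by apply: commg_subI; rewrite subsetI subxx.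
  by move/subsetP; apply.
have sylS1o : p.-Sylow(G) (S1 :^ o) by case/setIP: cDo => Go _; rewrite pHallJ.
have sT0_S1oT1 : T0 \subset S1 :^ o :&: T1.
  by rewrite subsetI sT01 defT0 conjSg sS01.
have [||c cDc defT1'] := step (S1 :^ o)%G T1 sylS1o sylT1 => /=.
- exact: subset_trans (proper_sub ltDT0) sT0_S1oT1.
- exact: leq_trans (proper_card ltDT0) (subset_leq_card sT0_S1oT1).
exists (a * o * c * b^-1); first by rewrite !groupM ?groupV.
by rewrite !conjsgM -defS1 -defT1' defT1 conjsgK.
Qed.

(** The element c that centralises P :^ g :&: P and maps P :^ g to P fixes
    x ^ g. So g * c acts on x like g and normalises P, hence acts on x as an
    element of P, because 'O_p^'('N_G(P)) centralises P. *)
Lemma Sylow_controls_fusion P x g :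
    p.-Sylow(G) P -> x \in P -> g \in G -> x ^ g \in P ->
  exists2 y, y \in P & x ^ g = x ^ y.
Proof.
move=> sylP Px Gg Pxg; have [sPG pP _] := and3P sylP.
have [P1 | ntP] := eqVneq (P : {set gT}) 1.
  by exists 1 => //; move: Px; rewrite P1 => /set1P->; rewrite !conj1g.
have sylPg : p.-Sylow(G) (P :^ g)%G by rewrite pHallJ.
have [c /setIP[Gc cDc] /= defP] := Sylow_conj_cent sylPg sylP.
have xgc : x ^ g = x ^ (g * c).
  by rewrite conjgM [RHS]conjgE -(centP cDc) ?mulKg // inE Pxg memJ_conjg Px.
have Ngc : g * c \in 'N_G(P).
  by rewrite inE groupM //; apply/normP; rewrite conjsgM -defP.
have sylPN : p.-Sylow('N_G(P)) P by rewrite Sylow_subnorm.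
have /sdprodP[_ mulOP nOP tiOP] : 'O_p^'('N_G(P)) ><| P = 'N_G(P).
  exact/sdprod_p'core_HallP/nilG.
move: Ngc; rewrite -mulOP => /mulsgP[o y Oo Py def_gc].
exists y; rewrite // xgc def_gc conjgM; congr (_ ^ y).
have cPO : 'O_p^'('N_G(P)) \subset 'C(P).
  rewrite centsC; apply/commG1P/trivgP; rewrite setIC in tiOP; rewrite -tiOP.
  apply: commg_subI; rewrite subsetI subxx //=.
  exact: subset_trans (pcore_sub _ _) (subsetIr _ _).
by rewrite conjgE -(centP (subsetP cPO o Oo) x Px) mulKg.
Qed.

(** By the focal subgroup theorem P :&: G^`(1) is P^`(1), a proper subgroup of
    the nontrivial p-group P. *)
Lemma p_local_nilpotent_der1_proper : p %| #|G| -> prime p -> G^`(1) \proper G.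
Proof.
move=> pG p_pr; rewrite properE der_sub; apply/negP=> sGG'.
have [P sylP] := Sylow_exists p G; have [sPG pP _] := and3P sylP.
have sPP' : P \subset P^`(1).
  apply: subset_trans (transfer_focal sylP _).
    by rewrite subsetI subxx (subset_trans sPG).
  by move=> x g Px Gg Pxg; apply: Sylow_controls_fusion sylP Px Gg Pxg.
have := sol_der1_proper (pgroup_sol pP) (subxx P).
rewrite properE sPP' andbF => ntP; have : P :!=: 1; last by move/ntP.
by rewrite -rank_gt0 (rank_Sylow sylP) p_rank_gt0 mem_primes p_pr cardG_gt0.
Qed.

End Fusion.

(** * Groups whose proper subgroups are supersolvable *)

(** Let p be the least prime divisor of |G|. Either a nontrivial p-subgroup is
    normal in G, and induction applies to the quotient, or all the p-local
    subgroups are proper, hence p-nilpotent, and then G^`(1) is proper, hence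
    supersolvable. *)
Lemma proper_supersolvable_sol (gT : finGroupType) (G : {group gT}) :
    (forall H : {group gT}, H \proper G -> supersolvable H) ->
  solvable G.
Proof.
have [n] := ubnP #|G|; elim: n => // n IHn in gT G * => /ltnSE-leGn ssG.
have [-> | ntG] := eqVneq (G : {set gT}) 1; first exact: solvable1.
pose p := pdiv #|G|.
have p_pr : prime p by rewrite pdiv_prime // cardG_gt1.
have [nilG | ] := boolP [forall D : {group gT}, [==> D \subset G, p.-group D,
                      D :!=: 1 => 'N_G(D) \proper G]].
  have ltG' : G^`(1) \proper G.
    apply: (@p_local_nilpotent_der1_proper _ p) => //; last exact: pdiv_dvd.
    move=> D sDG pD ntD.
    have /implyP/(_ sDG)/implyP/(_ pD)/implyP/(_ ntD) ltNG := forallP nilG D.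
    apply: supersolvable_p_nilpotent (ssG _ ltNG) => r piNr.
    have := piSg (proper_sub ltNG) piNr.
    by rewrite mem_primes => /and3P[r_pr _ /(pdiv_min_dvd (prime_gt1 r_pr))].
  rewrite (series_sol (der_normal 1 G)) (supersolvable_sol (ssG _ ltG')).
  by rewrite abelian_sol // der_abelian.
rewrite negb_forall => /existsP[D]; rewrite !negb_imply => /and4P[sDG pD ntD].
rewrite properE subsetIl subsetI subxx negbK => nDG.
have nsDG : D <| G by apply/andP.
rewrite (series_sol nsDG) (pgroup_sol pD) /=; apply: IHn => [|H ltHG].
  by apply: leq_trans leGn; rewrite ltn_quotient.
pose K := (coset D @*^-1 H)%G; have ltKG : K \proper G.
  by rewrite -(quotientGK nsDG) cosetpre_proper.
have nsDK : D <| K := normalS (sub_cosetpre H) (proper_sub ltKG) nsDG.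
have <- : (K / D)%G = H by apply/group_inj/cosetpreK.
exact: quotient_supersolvable nsDK (ssG K ltKG).
Qed.

(** * Huppert's criterion *)

Section Eigenvector.

Import GRing.Theory.

(** Over F_p, the matrix of h is a root of 'X^p - 'X, which splits, so it has
    an eigenvector. *)
Lemma abelem_eigenvector (gT : finGroupType) p (V : {group gT}) h :
    prime p -> p.-abelem V -> V :!=: 1 -> h \in 'N(V) -> h ^+ p.-1 \in 'C(V) ->
  exists2 v, v \in V^# & exists k, v ^ h = v ^+ k.
Proof.
move=> p_pr abelV ntV nVh cVhp.
have nVH : <[h]> \subset 'N(V) by rewrite cycle_subG.
pose rH := abelem_repr abelV ntV nVH; pose A := rH h; have Hh := cycle_id h.
have ApA : (A ^+ p = A)%R.
  have rhp : rH (h ^+ p.-1) = 1%:M%R.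
    have : h ^+ p.-1 \in rker rH by rewrite rker_abelem inE mem_cycle.
    by rewrite inE mul1mx => /andP[_ /eqP].
  have : (A ^+ p.-1.+1 = A)%R.
    by rewrite exprSr -[(A ^+ _)%R]repr_mxX // rhp mul1r.
  by rewrite (prednK (prime_gt0 p_pr)).
have : (\prod_(a : 'F_p) (A - a%:M) = 0)%R.
  have := congr1 (horner_mx A) (finField_genPoly 'F_p).
  rewrite card_Fp // rmorphB rmorphXn rmorph_prod /= horner_mx_X ApA subrr.
  by move->; apply: eq_bigr => a _; rewrite rmorphB /= horner_mx_X horner_mx_C.
move/(congr1 (fun B => \det B)%R); rewrite det0 => /eqP.
have -> : (\det (\prod_(a : 'F_p) (A - a%:M)) =
            \prod_(a : 'F_p) \det (A - a%:M))%R.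
  by apply: (big_morph (fun B => \det B)%R); [apply: det_mulmx | apply: det1].
case/prodf_eq0=> a _ /det0P[v nz_v /eqP].
rewrite mulmxBr mul_mx_scalar subr_eq0 => /eqP vA.
exists (rVabelem abelV ntV v).
  rewrite !inE mem_rVabelem andbT; apply: contraNneq nz_v => v1.
  by rewrite -(inj_eq (@rVabelem_inj _ _ _ abelV ntV)) v1 rVabelem0.
by exists a; rewrite -(rVabelemJ _ _ nVH v Hh) -/rH -/A vA rVabelemZ.
Qed.

End Eigenvector.

Section CoprimeCentralizer.

Variables (gT : finGroupType) (p : nat) (P A : {group gT}).
Hypotheses (pP : p.-group P) (p'A : p^'.-group A) (nPA : A \subset 'N(P)).

Lemma coprime_quotient_cent_eq (N : {group gT}) :
    N <| P -> A \subset 'N(N) -> A / N \subset 'C(P / N) ->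
  P \subset N * 'C_P(A).
Proof.
move=> /andP[sNP nNP] nNA cPA.
have coPA : coprime #|P| #|A| := pnat_coprime pP p'A.
rewrite -quotientSK // (coprime_quotient_cent sNP nNA coPA (pgroup_sol pP)).
by rewrite subsetI subxx centsC.
Qed.

Lemma coprime_cent_of_quotient (N : {group gT}) :
    N <| P -> A \subset 'C(N) -> A / N \subset 'C(P / N) ->
  A \subset 'C(P).
Proof.
move=> nsNP cNA cPA; have nNA := subset_trans cNA (cent_sub N).
have := coprime_quotient_cent_eq nsNP nNA cPA.
rewrite mulSGid; last by rewrite subsetI normal_sub // centsC.
by rewrite subsetI subxx centsC.
Qed.

(** The centraliser of A in P covers P / Phi(P), so it generates P. *)
Lemma coprime_cent_Phi_quotient :
  A / 'Phi(P) \subset 'C(P / 'Phi(P)) -> A \subset 'C(P).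
Proof.
move=> cPA; have nPhiA : A \subset 'N('Phi(P)) := gFnorm_trans _ nPA.
have sP := coprime_quotient_cent_eq (Phi_normal P) nPhiA cPA.
have : <<'C_P(A)>> = P.
  apply: Phi_nongen; apply/eqP; rewrite eqEsubset join_subG Phi_sub subsetIl.
  by apply: subset_trans sP _; rewrite mul_subG ?joing_subl ?joing_subr.
by rewrite genGid => /setIidPl; rewrite centsC.
Qed.

End CoprimeCentralizer.

(** On a chief factor of order p, G induces a subgroup of a cyclic group of
    order p.-1, so commutators and p.-1-st powers centralise all the factors of
    a G-invariant series of P. A p'-element with this property centralises P. *)
Lemma supersolvable_coprime_cent (gT : finGroupType) (p : nat)
    (G P : {group gT}) y :
    supersolvable G -> P <| G -> p.-group P -> y \in G -> p^'.-elt y ->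
    (exists a b, [/\ a \in G, b \in G & y = [~ a, b]])
      \/ (exists2 a, a \in G & y = a ^+ p.-1) ->
  <[y]> \subset 'C(P).
Proof.
have [n] := ubnP #|G|; elim: n => // n IHn in gT G P y *.
move=> /ltnSE-leGn ssG nsPG pP Gy p'y y_ab.
have [-> | ntP] := eqVneq (P : {set gT}) 1; first by rewrite cents1.
have [N [nsNG sNP prN]] := supersolvable_prime_normal ssG nsPG ntP.
have oN : #|N| = p.
  by have := pgroupS sNP pP; rewrite /pgroup pnatE // => /eqnP.
have nNG := normal_norm nsNG.
have nNy := subsetP nNG y Gy.
have cycN := prime_cyclic prN.
have cNy : y \in 'C(N).
  rewrite -ker_conj_aut; apply/kerP => //.
  case: y_ab nNy {Gy p'y} => [[a [b [Ga Gb ->]]] | [a Ga ->]] _.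
    have [Na Nb] := (subsetP nNG a Ga, subsetP nNG b Gb).
    rewrite morphR //=; apply/eqP/commgP.
    by apply: (centsP (Aut_cyclic_abelian cycN)); apply: Aut_aut.
  have Na := subsetP nNG a Ga; rewrite morphX //=.
  rewrite -(totient_prime (_ : prime p)).
    rewrite -oN -card_Aut_cyclic //; apply: expg_cardG; exact: Aut_aut.
  by rewrite -oN.
have cNY : <[y]> \subset 'C(N) by rewrite cycle_subG.
have nsNP : N <| P := normalS sNP (normal_sub nsPG) nsNG.
apply: (coprime_cent_of_quotient pP p'y nsNP cNY).
rewrite quotient_cycle //.
apply: (IHn _ (G / N)%G (P / N)%G);
  rewrite ?quotient_supersolvable ?quotient_normal ?quotient_pgroup //.
- apply: leq_trans leGn.
  by rewrite ltn_quotient ?normal_sub // -cardG_gt1 prime_gt1.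
- exact: mem_quotient.
- exact: morph_p_elt.
case: y_ab nNy {Gy p'y cNy cNY} => [[a [b [Ga Gb ->]]] | [a Ga ->]] _.
  left; exists (coset N a), (coset N b); rewrite !mem_quotient //.
  by rewrite morphR ?(subsetP nNG).
by right; exists (coset N a); rewrite ?mem_quotient // morphX ?(subsetP nNG).
Qed.

Lemma minnormal_normal (gT : finGroupType) (G H N : {group gT}) :
  minnormal N G -> N \subset H -> H <| G -> N <| G.
Proof.
move=> /mingroupp/andP[_ nNG] sNH nsHG.
by rewrite /normal nNG (subset_trans sNH) ?normal_sub.
Qed.

(** The intersection is normalised by M and by the abelian group N. *)
Lemma minnormal_compl (gT : finGroupType) (G N M : {group gT}) :
    minnormal N G -> N <| G -> abelian N -> maximal M G -> ~~ (N \subset M) ->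
  N :&: M = 1.
Proof.
move=> /mingroupP[_ minN] nsNG abN maxM not_sNM.
have defG := maximal_normal_mul maxM nsNG not_sNM.
apply: contraNeq not_sNM => ntNM; apply/setIidPl/(minN (N :&: M)%G).
  rewrite ntNM -defG mul_subG //=.
    by rewrite cents_norm // (subset_trans abN) ?centS ?subsetIl.
  have sMG : M \subset G := proper_sub (maxgroupp maxM).
  by rewrite normsI ?normG // (subset_trans sMG (normal_norm nsNG)).
exact: subsetIl.
Qed.

Lemma minnormal_maximal_index (gT : finGroupType) (G N M : {group gT}) :
    minnormal N G -> N <| G -> abelian N -> maximal M G -> ~~ (N \subset M) ->
  #|G : M| = #|N|.
Proof.
move=> minN nsNG abN maxM not_sNM.
rewrite -divgS ?(proper_sub (maxgroupp maxM)) //.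
rewrite -(maximal_normal_mul maxM nsNG not_sNM).
by rewrite TI_cardMg ?(minnormal_compl minN) // mulnK.
Qed.

(** H induces on P an abelian group of exponent dividing p.-1, so each element
    of H has an eigenvector in the irreducible module N. As P centralises N, the
    eigenspace is invariant under P * H, hence is the whole of N. Thus H acts on
    N by power maps, and each cyclic subgroup of N is normal in G. *)
Lemma minnormal_power_action_cyclic (gT : finGroupType) (p : nat)
    (G P H N : {group gT}) :
    prime p -> p.-group P -> P <| G -> P * H = G -> N \subset P ->
    minnormal N G ->
    (forall a b, a \in H -> b \in H -> [~ a, b] \in 'C(P)) ->
    (forall a, a \in H -> a ^+ p.-1 \in 'C(P)) ->
  cyclic N.
Proof.
move=> p_pr pP nsPG defG sNP minN cPR cPX.
have nsNG := minnormal_normal minN sNP nsPG.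
have [/andP[ntN nNG] minimN] := mingroupP minN.
have sHG : H \subset G by rewrite -defG mulG_subr.
have nNP := subset_trans (normal_sub nsPG) nNG.
have nNH := subset_trans sHG nNG.
have abelN : p.-abelem N.
  have [_ _ /is_abelemP[q q_pr abelN]] :=
    minnormal_solvable minN (subxx N) (pgroup_sol (pgroupS sNP pP)).
  have /andP[qN _] := abelN.
  have [r_pr rN _] := pgroup_pdiv (pgroupS sNP pP) ntN.
  by have /eqP-> : p == q := pgroupP qN p r_pr rN.
have abN := abelem_abelian abelN.
have cNP : P \subset 'C(N).
  suff: N \subset 'Z(P) by rewrite subsetI centsC => /andP[].
  apply/setIidPl/(minimN (N :&: 'Z(P))%G); last exact: subsetIl.
  rewrite meet_center_nil ?(pgroup_nil pP) /normal ?sNP //=.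
  by rewrite normsI // (char_norm_trans (center_char P)) ?normal_norm.
have powN a : a \in H -> exists k, {in N, forall u, u ^ a = u ^+ k}.
  move=> Ha; have nNa := subsetP nNH a Ha.
  have cNap : a ^+ p.-1 \in 'C(N) by apply: subsetP (centS sNP) _ (cPX a Ha).
  have [v /setD1P[ntv Nv] [k va]] := abelem_eigenvector p_pr abelN ntN nNa cNap.
  exists k; pose E := [set u in N | u ^ a == u ^+ k].
  have EP u : reflect (u \in N /\ u ^ a = u ^+ k) (u \in E).
    by rewrite inE; apply: (iffP andP) => [] [? /eqP].
  have gE : group_set E.
    apply/group_setP; split=> [|u w /EP[Nu ua] /EP[Nw wa]]; apply/EP.
      by rewrite conj1g expg1n.
    by rewrite groupM // conjMg ua wa expgMn //; apply: (centsP abN).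
  suff defE : Group gE :=: N by move=> u; rewrite -{1}defE => /EP[].
  apply: minimN; last by apply/subsetP=> u /EP[].
  apply/andP; split.
    by apply/trivgPn; exists v => //; apply/EP.
  rewrite -defG mul_subG //.
    rewrite cents_norm // (subset_trans cNP) // centS //.
    by apply/subsetP=> u /EP[].
  apply/subsetP=> b Hb; rewrite inE; apply/subsetP=> _ /imsetP[u /EP[Nu ua] ->].
  have Nub c : c \in H -> u ^ c \in N.
    by move=> Hc; rewrite memJ_norm ?(subsetP nNH).
  apply/EP; split; first exact: Nub.
  rewrite -conjgM (commgC b a) (conjgM u) (conjgM u) ua conjXg.
  rewrite [LHS]conjgE -(centP (cPR b a Hb Ha)) ?mulKg //.
  by rewrite groupX // (subsetP sNP) ?Nub.
have [u Nu ntu] := trivgPn _ ntN.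
suff: <[u]> = N by move=> <-; apply: cycle_cyclic.
apply: (minimN <[u]>%G); last by rewrite cycle_subG.
rewrite cycle_eq1 ntu /= -defG mul_subG //.
  by rewrite cents_norm // (subset_trans cNP) ?centS ?cycle_subG.
apply/subsetP=> a Ha; have [k powa] := powN a Ha.
by rewrite inE -cycleJ powa // cycleX.
Qed.

(** By induction a cyclic normal subgroup suffices. Let P be the Sylow subgroup
    for the largest prime divisor p of |G|; it is normal in G. If Phi(P) = 1, a
    minimal normal subgroup N inside P is complemented in G by the theorem of
    Gaschuetz, and |N| is the index of a maximal subgroup above the complement.
    Otherwise take N inside Phi(P). As G / Phi(P) is supersolvable, commutators
    and p.-1-st powers in a complement H of P centralise P / Phi(P), hence P. *)
Theorem Huppert_supersolvable (gT : finGroupType) (G : {group gT}) :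
    solvable G ->
    (forall M : {group gT}, maximal M G -> prime #|G : M|) ->
  supersolvable G.
Proof.
have [n] := ubnP #|G|; elim: n => // n IHn in gT G * => /ltnSE-leGn solG prM.
have [/group_inj-> | ntG] := eqVneq (G : {set gT}) 1.
  exact: supersolvable1.
have quo (N : {group gT}) : N <| G -> N :!=: 1 -> supersolvable (G / N).
  move=> nsNG ntN; apply: IHn (quotient_sol N solG) _ => [|M maxM].
    by apply: leq_trans leGn; rewrite ltn_quotient ?normal_sub.
  rewrite -index_cosetpre /= quotientGK // prM //.
  by rewrite -(quotientGK nsNG) cosetpre_maximal.
suff [N [nsNG ntN cycN]] :
    exists N : {group gT}, [/\ N <| G, N :!=: 1 & cyclic N].
  exact: supersolvable_cyclic_ext nsNG cycN (quo N nsNG ntN).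
pose p := max_pdiv #|G|.
have p_pr : prime p by rewrite max_pdiv_prime ?cardG_gt1.
have [P sylP] := Sylow_exists p G; have [sPG pP p'GP] := and3P sylP.
have nsPG : P <| G.
  by apply: prime_index_Sylow_normal sylP => //; apply: pi_leq_max_pdiv.
have ntP : P :!=: 1.
  by rewrite -rank_gt0 (rank_Sylow sylP) p_rank_gt0 pi_max_pdiv cardG_gt1.
have [PhiP1 | ntPhi] := eqVneq 'Phi(P) 1.
  have abelP : p.-abelem P by rewrite -trivg_Phi // PhiP1.
  have [N minN sNP] := minnormal_exists ntP (normal_norm nsPG).
  have nsNG := minnormal_normal minN sNP nsPG.
  have abN : abelian N := abelianS sNP (abelem_abelian abelP).
  have ntN : N :!=: 1 by case/andP: (mingroupp minN).
  have [X /complP[tiNX defG]] : exists X, X \in [complements to N in G].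
    apply/splitsP; rewrite (Gaschutz_split nsNG sNP sPG abN) ?abelem_splits //.
      exact: abelem_splits abelP sNP.
    exact: pnat_coprime (pgroupS sNP pP) p'GP.
  have sXG : X \subset G by rewrite -defG mulG_subr.
  have [defX | [M maxM sXM]] := maximal_exists sXG.
    by rewrite -tiNX defX (setIidPl (normal_sub nsNG)) eqxx in ntN.
  have not_sNM : ~~ (N \subset M).
    have /andP[_] := maxgroupp maxM; apply: contra => sNM.
    by rewrite -defG mul_subG.
  exists N; split=> //; apply: prime_cyclic.
  by rewrite -(minnormal_maximal_index minN nsNG abN maxM not_sNM) prM.
have nsPhiG : 'Phi(P) <| G := char_normal_trans (Phi_char P) nsPG.
have ssPhi : supersolvable (G / 'Phi(P)) := quo 'Phi(P)%G nsPhiG ntPhi.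
have [N minN sNPhi] := minnormal_exists ntPhi (normal_norm nsPhiG).
have sNP := subset_trans sNPhi (Phi_sub P).
have nsNG := minnormal_normal minN sNPhi nsPhiG.
have [H /complP[tiPH defG]] : exists H, H \in [complements to P in G].
  exact/splitsP/(SchurZassenhaus_split (pHall_Hall sylP) nsPG).
have sHG : H \subset G by rewrite -defG mulG_subr.
have p'H : p^'.-group H.
  rewrite /pgroup -(_ : #|G : P| = #|H|) //.
  by rewrite -divgS // -defG TI_cardMg // mulKn.
have centP y : y \in H ->
     (exists a b, [/\ a \in H, b \in H & y = [~ a, b]])
      \/ (exists2 a, a \in H & y = a ^+ p.-1) ->
  y \in 'C(P).
  move=> Hy y_ab; have Gy := subsetP sHG y Hy.
  have nPhi := subsetP (normal_norm nsPhiG).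
  have p'y : p^'.-elt y := mem_p_elt p'H Hy.
  rewrite -cycle_subG; apply: (coprime_cent_Phi_quotient pP p'y).
    by rewrite cycle_subG (subsetP (normal_norm nsPG)).
  rewrite quotient_cycle ?nPhi //.
  apply: (supersolvable_coprime_cent ssPhi (quotient_normal _ nsPG)).
  - exact: quotient_pgroup pP.
  - exact: mem_quotient.
  - exact: morph_p_elt (nPhi y Gy) p'y.
  case: y_ab => [[a [b [Ha Hb ->]]] | [a Ha ->]].
    have [Ga Gb] := (subsetP sHG a Ha, subsetP sHG b Hb).
    left; exists (coset 'Phi(P) a), (coset 'Phi(P) b).
    by rewrite !mem_quotient // morphR ?nPhi.
  have Ga := subsetP sHG a Ha.
  by right; exists (coset 'Phi(P) a); rewrite ?mem_quotient // morphX ?nPhi.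
exists N; split=> //; first by case/andP: (mingroupp minN).
apply: (minnormal_power_action_cyclic p_pr pP nsPG defG sNP minN).
  by move=> a b Ha Hb; apply: centP; [rewrite groupR | left; exists a, b].
by move=> a Ha; apply: centP; [rewrite groupX | right; exists a].
Qed.

(** * Primitive solvable groups *)

Section Primitive.

Variables (gT : finGroupType) (G M : {group gT}).
Hypotheses (solG : solvable G) (maxM : maximal M G) (coreM : gcore M G = 1).

Let sMG : M \subset G := proper_sub (maxgroupp maxM).

(** The intersection of M with the centraliser of L is normalised by M and
    centralised by L, so it lies in the trivial core of M. *)
Lemma primitive_solvable_socle :
  exists L : {group gT}, exists p,
    [/\ minnormal L G, L <| G, p.-abelem L, ~~ (L \subset M) & 'C_G(L) = L].
Proof.
have ntG : G :!=: 1.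
  apply: contraTneq (maxgroupp maxM) => ->.
  by rewrite properE sub1G andbF.
have [L minL sLG] := minnormal_exists ntG (normG G).
have [nLG _ /is_abelemP[p p_pr abelL]] := minnormal_solvable minL sLG solG.
have nsLG : L <| G by apply/andP.
have not_sLM : ~~ (L \subset M).
  apply/negP=> sLM; have /andP[] := mingroupp minL.
  by rewrite -subG1 -coreM sub_gcore ?sLM.
have abL := abelem_abelian abelL.
exists L, p; split=> //; pose C := 'C_G(L).
have sLC : L \subset C by rewrite subsetI sLG.
have defG := maximal_normal_mul maxM nsLG not_sLM.
have nsCG : C <| G by rewrite /normal subsetIl normsI ?normG ?norms_cent.
suff CM1 : C :&: M = 1.
  rewrite -/C -(setIidPl (normal_sub nsCG)) -defG setIC -group_modl //.
  by rewrite setIC CM1 mulg1.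
apply/trivgP; rewrite -coreM sub_gcore ?subsetIr // -defG mul_subG //.
  rewrite cents_norm // centsC (subset_trans (subsetIl _ _)) //.
  exact: subsetIr.
by rewrite normsI ?normG // (subset_trans sMG (normal_norm nsCG)).
Qed.

(** The socle L has prime order |G : M|, and G / L embeds in Aut(L). *)
Lemma prime_primitive_supersolvable : prime #|G : M| -> supersolvable G.
Proof.
have [L [p [minL nsLG abelL not_sLM defCL]]] := primitive_solvable_socle.
have abL := abelem_abelian abelL.
rewrite (minnormal_maximal_index minL nsLG abL maxM not_sLM) => prL.
apply: (supersolvable_cyclic_ext nsLG (prime_cyclic prL)).
suff cGL : cyclic (G / L).
  apply: (supersolvable_cyclic_ext (normal_refl _) cGL).
  have -> : (G / L / (G / L))%G = 1%G by apply/group_inj/trivg_quotient.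
  exact: supersolvable1.
have := first_isog_loc (conj_aut_morphism L) (normal_norm nsLG).
rewrite ker_conj_aut defCL => /isog_cyclic->.
apply: cyclicS (Aut_prime_cyclic prL).
exact: Aut_conj_aut.
Qed.

(** The socle L is complemented by M. Suppose that p divides |M|, and let S be
    the Sylow subgroup of M for the largest prime divisor s of |M|; it is normal
    in M. If s = p, the p-group L S is normal in G and its centre contains L. If
    s > p, then L S is a proper subgroup, hence supersolvable, and S is normal
    in it. In both cases S centralises L, against the self-centralisation of
    L. *)
Lemma primitive_supersolvable_Sylow :
    (forall H : {group gT}, H \proper G -> supersolvable H) ->
  exists L : {group gT}, exists p,
    [/\ minnormal L G, prime p, L :!=: 1 & p.-Sylow(G) L].
Proof.
move=> ssG.
have [L [p [minL nsLG abelL not_sLM defCL]]] := primitive_solvable_socle.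
have [/andP[ntL nLG] minimL] := mingroupP minL.
have [pL abL _] := and3P abelL; have [p_pr _ _] := pgroup_pdiv pL ntL.
exists L, p; split=> //; rewrite /pHall normal_sub ?pL //=.
have tiLM := minnormal_compl minL nsLG abL maxM not_sLM.
have defG := maximal_normal_mul maxM nsLG not_sLM.
have nLM := subset_trans sMG nLG.
have -> : #|G : L| = #|M|.
  by rewrite -divgS ?normal_sub // -defG TI_cardMg // mulKn.
apply: contraT => not_p'M; have ntM : M :!=: 1.
  by apply: contraNneq not_p'M => ->; rewrite cards1.
pose s := max_pdiv #|M|.
have s_pr : prime s by rewrite max_pdiv_prime ?cardG_gt1.
have [S sylS] := Sylow_exists s M; have [sSM sS s'MS] := and3P sylS.
have ssM : supersolvable M := ssG M (maxgroupp maxM).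
have nsSM : S <| M.
  exact: supersolvable_Sylow_normal s_pr (@pi_leq_max_pdiv _ M) ssM sylS.
have ntS : S :!=: 1.
  by rewrite -rank_gt0 (rank_Sylow sylS) p_rank_gt0 pi_max_pdiv cardG_gt1.
have nLS := subset_trans sSM nLM; have sSG := subset_trans sSM sMG.
suff cLS : S \subset 'C(L).
  have sSL : S \subset L by rewrite -defCL subsetI sSG.
  by rewrite -subG1 -tiLM subsetI sSL sSM in ntS.
pose T := (L <*> S)%G.
have [defT sLT sST] : [/\ T = L * S :> {set gT}, L \subset T & S \subset T].
  by rewrite /T /= norm_joinEr // mulG_subl mulG_subr.
(* L meets the centre of the p-group T, and L is a minimal normal subgroup. *)
have [s_p | neq_sp] := eqVneq s p.
  have pT : p.-group T by rewrite /T /= norm_joinEr // pgroupM pL -s_p.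
  have nsLT : L <| T by rewrite /normal sLT defT mul_subG ?normG.
  suff : L \subset 'Z(T).
    by rewrite subsetI centsC => /andP[_]; apply: subset_trans.
  apply/setIidPl/(minimL (L :&: 'Z(T))%G); last exact: subsetIl.
  rewrite meet_center_nil ?(pgroup_nil pT) //=.
  have nTG : G \subset 'N(T).
    rewrite -defG mul_subG //; first exact: subset_trans (sLT) (normG T).
    by rewrite normsY // normal_norm.
  by rewrite normsI // (char_norm_trans (center_char T)).
have p_piM : p \in \pi(M).
  apply: contraR not_p'M => p'M; apply/pgroupP=> q q_pr qM.
  apply: contraNneq p'M => <-.
  by rewrite mem_primes q_pr cardG_gt0.
have tiLS : L :&: S = 1.
  apply: coprime_TIg (pnat_coprime pL _).
  by apply: sub_in_pnat sS => q _ /eqnP->.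
have oT : #|T| = (#|L| * #|S|)%N by rewrite defT TI_cardMg.
have ltTG : T \proper G.
  have sTG : T \subset G by rewrite join_subG normal_sub.
  rewrite properEcard sTG oT -defG TI_cardMg // ltn_pmul2l ?cardG_gt0 //.
  rewrite proper_card // properEneq sSM andbT.
  apply: contraTneq p_piM => <-; apply: contra neq_sp => /(pnatPpi sS).
  by rewrite inE /= eq_sym.
have sylST : s.-Sylow(T) S.
  rewrite /pHall sST sS -divgS // oT mulnK //.
  by apply: sub_in_pnat pL => q _ /eqnP->; rewrite !inE eq_sym.
have nsST : S <| T.
  apply: (supersolvable_Sylow_normal s_pr _ (ssG T ltTG) sylST) => q.
  rewrite mem_primes => /and3P[q_pr _] /=; rewrite oT Euclid_dvdM //.
  case/orP=> [/(pgroupP pL q q_pr)/eqnP-> | /(pgroupP sS q q_pr)/eqnP-> //].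
  exact: pi_leq_max_pdiv p_piM.
apply/commG1P/trivgP; rewrite -tiLS setIC.
by apply: commg_subI; rewrite subsetI subxx //= (subset_trans sLT) ?normal_norm.
Qed.

End Primitive.

Section CoreQuotient.

Variables (gT : finGroupType) (G M : {group gT}).
Hypothesis maxM : maximal M G.

Let sMG : M \subset G := proper_sub (maxgroupp maxM).
Let nsFG : gcore M G <| G := gcore_normal sMG.
Let nsFM : gcore M G <| M := normalS (gcore_sub M G) sMG nsFG.

Lemma quotient_gcore_maximal : maximal (M / gcore M G) (G / gcore M G).
Proof. by rewrite quotient_maximal. Qed.

Lemma quotient_gcore_index : #|G / gcore M G : M / gcore M G| = #|G : M|.
Proof.
rewrite index_quotient_eq ?normal_norm //.
by rewrite subIset // gcore_sub orbT.
Qed.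

Lemma gcore_quotient_gcore : gcore (M / gcore M G) (G / gcore M G) = 1.
Proof.
set F := gcore M G; set K := gcore _ _.
have nsKG : K <| G / F by apply: gcore_normal; apply: quotientS.
suff defF : coset F @*^-1 K = F by rewrite -(cosetpreK K) defF trivg_quotient.
apply/eqP; rewrite eqEsubset sub_cosetpre andbT sub_gcore.
  by rewrite -(quotientGK nsFM) morphpreS ?gcore_sub.
have: coset F @*^-1 K <| G by rewrite -(quotientGK nsFG) cosetpre_normal.
exact: normal_norm.
Qed.

End CoreQuotient.

(** In a solvable group this quotient is a primitive group of prime degree. *)
Lemma prime_index_quotient_supersolvable (gT : finGroupType)
    (G M : {group gT}) :
    solvable G -> maximal M G -> prime #|G : M| ->
  supersolvable (G / gcore M G).
Proof.
move=> solG maxM prGM.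
apply: (@prime_primitive_supersolvable _ _ (M / gcore M G)%G).
- exact: quotient_sol.
- exact: quotient_gcore_maximal.
- exact: gcore_quotient_gcore.
by rewrite quotient_gcore_index.
Qed.

Lemma nonprime_index_quotient_not_supersolvable (gT : finGroupType)
    (G M : {group gT}) :
  maximal M G -> ~~ prime #|G : M| -> ~~ supersolvable (G / gcore M G).
Proof.
move=> maxM; apply: contra => ssGF; rewrite -quotient_gcore_index //.
exact: supersolvable_maximal_index ssGF (quotient_gcore_maximal maxM).
Qed.

Lemma supersolvable_quotientS (gT : finGroupType) (G N K : {group gT}) :
    N <| G -> K <| G -> N \subset K -> supersolvable (G / N) ->
  supersolvable (G / K).
Proof.
move=> nsNG nsKG sNK ssGN.
apply: isog_supersolvable (third_isog sNK nsNG nsKG) _.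
by apply: quotient_supersolvable => //; apply: quotient_normal.
Qed.

Lemma Phi_sub_gcore (gT : finGroupType) (G M : {group gT}) :
  maximal M G -> 'Phi(G) \subset gcore M G.
Proof.
by move=> maxM; rewrite sub_gcore ?Phi_sub_max ?normal_norm ?Phi_normal.
Qed.

(** If Phi(N) were not contained in a maximal subgroup X of G, then Dedekind's
    law would give N = Phi(N) (N :&: X), hence N :&: X = N. *)
Lemma Phi_normal_sub (gT : finGroupType) (G N : {group gT}) :
  N <| G -> 'Phi(N) \subset 'Phi(G).
Proof.
move=> nsNG; have nsPhi := char_normal_trans (Phi_char N) nsNG.
apply/bigcapsP=> X /predU1P[-> | maxX]; first exact: normal_sub.
apply: contraT => not_sPX; have defG := maximal_normal_mul maxX nsPhi not_sPX.
have defN : 'Phi(N) <*> (N :&: X) = N.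
  rewrite norm_joinEr; last first.
    by rewrite subIset // normal_norm ?Phi_normal.
  rewrite /= setIC group_modl ?Phi_sub // defG setIC.
  exact/setIidPl/normal_sub.
have := Phi_nongen defN; rewrite genGid => /setIidPl sNX.
by case/negP: not_sPX; apply: subset_trans (Phi_sub N) sNX.
Qed.

(** * The structure of minimal non-supersolvable groups *)

Section MinimalNonSupersolvable.

Variables (gT : finGroupType) (G : {group gT}).
Hypothesis ssG : forall H : {group gT}, H \proper G -> supersolvable H.

Let R := supersolvable_residual G.

(** A maximal subgroup X that does not contain N maps onto G / N. *)
Lemma nonsupersolvable_quotient_Phi (N : {group gT}) :
  N <| G -> ~~ supersolvable (G / N) -> N \subset 'Phi(G).
Proof.
move=> nsNG nssGN; apply/bigcapsP=> X /predU1P[-> | maxX].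
  exact: normal_sub.
apply: contraR nssGN => not_sNX.
have sXG : X \subset G := proper_sub (maxgroupp maxX).
have -> : (G / N)%G = (X / N)%G.
  apply/group_inj; rewrite /= -(maximal_normal_mul maxX nsNG not_sNX).
  by rewrite quotientMidl.
apply: morphim_supersolvable; last exact: ssG (maxgroupp maxX).
exact: subset_trans sXG (normal_norm nsNG).
Qed.

Variable M : {group gT}.
Hypotheses (maxM : maximal M G) (nprM : ~~ prime #|G : M|).

Lemma nonprime_residual_mul : R * M = G.
Proof.
have sMG := proper_sub (maxgroupp maxM).
have [nsRG ssGR _] := supersolvable_residual_min G.
apply: (maximal_normal_mul maxM nsRG); apply: contra nprM => sRM.
have nsRM := normalS sRM sMG nsRG; have <- : #|G / R : M / R| = #|G : M|.
  by rewrite index_quotient_eq ?normal_norm // subIset // sRM orbT.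
by apply: supersolvable_maximal_index ssGR _; rewrite quotient_maximal.
Qed.

Lemma nonprime_gcore_Phi (T : {group gT}) :
  maximal T G -> ~~ prime #|G : T| -> gcore T G = 'Phi(G).
Proof.
move=> maxT nprT; apply/eqP; rewrite eqEsubset Phi_sub_gcore // andbT.
apply: nonsupersolvable_quotient_Phi.
  exact: gcore_normal (proper_sub (maxgroupp maxT)).
exact: nonprime_index_quotient_not_supersolvable.
Qed.

(** With F the core of M, the socle L / F of G / F is a Sylow p-subgroup of
    G / F. As F = Phi(G), the Frattini argument shows that a Sylow p-subgroup
    P of L is normal in G. By Huppert's criterion G / P is supersolvable, since
    the core of a maximal subgroup containing P cannot be F. So R lies in P,
    and R F = L because L / F is a chief factor. A complement H of P in G then
    satisfies G = R Phi(G) H = R H, so that R = P. *)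
Lemma residual_Sylow : solvable G -> exists2 p, prime p & p.-Sylow(G) R.
Proof.
move=> solG; have sMG := proper_sub (maxgroupp maxM).
pose F := [group of gcore M G].
have nsFG : F <| G := gcore_normal sMG.
have defF : F = 'Phi(G) :> {set gT} := nonprime_gcore_Phi maxM nprM.
have [nsRG ssGR minR] := supersolvable_residual_min G.
have [||||Lb [p [minL p_pr ntL sylL]]] :=
    @primitive_supersolvable_Sylow _ (G / F)%G (M / F)%G.
- exact: quotient_sol.
- exact: quotient_gcore_maximal.
- exact: gcore_quotient_gcore.
- move=> H ltHG; pose K := (coset F @*^-1 H)%G.
  have ltKG : K \proper G by rewrite -(quotientGK nsFG) cosetpre_proper.
  have nsFK : F <| K := normalS (sub_cosetpre H) (proper_sub ltKG) nsFG.
  have <- : (K / F)%G = H by apply/group_inj/cosetpreK.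
  exact: quotient_supersolvable nsFK (ssG ltKG).
exists p => //; pose L := (coset F @*^-1 Lb)%G.
have defLb : L / F = Lb := cosetpreK Lb.
have nsLG : L <| G.
  rewrite -(quotientGK nsFG) cosetpre_normal /normal (pHall_sub sylL).
  by case/andP: (mingroupp minL).
have sFL : F \subset L := sub_cosetpre Lb.
have p'GL : p^'.-nat #|G : L|.
  by rewrite -(quotientGK nsFG) index_cosetpre; case/and3P: sylL.
have [P sylPL] := Sylow_exists p L; have [sPL pP p'LP] := and3P sylPL.
have sPG := subset_trans sPL (normal_sub nsLG).
have sylP : p.-Sylow(G) P.
  by rewrite /pHall sPG pP -(Lagrange_index (normal_sub nsLG) sPL) pnatM p'GL.
have nFP : P \subset 'N(F) := subset_trans sPG (normal_norm nsFG).
have defPF : P / F = Lb.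
  rewrite -defLb; apply: (pHall_id (quotient_pHall nFP sylPL)).
  by rewrite /= defLb; apply: pHall_pgroup sylL.
have nFL : L \subset 'N(F) := subset_trans (normal_sub nsLG) (normal_norm nsFG).
have sLFP : L \subset F * P by rewrite -quotientSK // defPF defLb.
have nsPG : P <| G.
  rewrite /normal sPG -{1}(@Phi_nongen _ G 'N_G(P)) ?gen_subG ?subsetIr //.
  apply/eqP; rewrite eqEsubset join_subG Phi_sub subsetIl /= -defF.
  rewrite -{1}(Frattini_arg nsLG sylPL) mul_subG ?joing_subr //.
  rewrite (subset_trans sLFP) // mul_subG ?joing_subl //.
  by rewrite sub_gen // subsetU // subsetI sPG normG orbT.
have not_sPF : ~~ (P \subset F).
  by apply: contra ntL => sPF; rewrite -subG1 -defPF quotient_sub1.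
have ssGP : supersolvable (G / P).
  apply: Huppert_supersolvable (quotient_sol P solG) _ => Tb maxTb.
  pose T := (coset P @*^-1 Tb)%G.
  have maxT : maximal T G by rewrite -(quotientGK nsPG) cosetpre_maximal.
  rewrite -index_cosetpre /= quotientGK //; apply: contraR not_sPF => nprT.
  rewrite defF -(nonprime_gcore_Phi maxT nprT) sub_gcore ?normal_norm //.
  exact: sub_cosetpre.
have sRP : R \subset P := minR P nsPG ssGP.
have not_sRF : ~~ (R \subset F).
  apply: contra (nonprime_index_quotient_not_supersolvable maxM nprM) => sRF.
  exact: supersolvable_quotientS nsRG nsFG sRF ssGR.
have nFR := subset_trans sRP nFP.
have defRF : R / F = Lb.
  have [_ minimL] := mingroupP minL.
  apply: (minimL (R / F)%G); last by rewrite -defPF quotientS.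
  by rewrite -subG1 quotient_sub1 // not_sRF quotient_norms ?normal_norm.
have sPFR : P \subset F * R by rewrite -quotientSK // defPF defRF.
have [H /complP[tiPH defG]] : exists H, H \in [complements to P in G].
  exact/splitsP/(SchurZassenhaus_split (pHall_Hall sylP) nsPG).
have sHG : H \subset G by rewrite -defG mulG_subr.
have defRH : R * H = G.
  have nRH := subset_trans sHG (normal_norm nsRG).
  rewrite -norm_joinEr // -[LHS]genGid; apply: Phi_nongen.
  apply/eqP; rewrite eqEsubset !join_subG Phi_sub normal_sub //= sHG.
  rewrite -{1}defG mul_subG //; last first.
    by rewrite sub_gen // subsetU // sub_gen ?orbT // subsetUr.
  rewrite (subset_trans sPFR) // mul_subG ?defF ?joing_subl //.
  by rewrite sub_gen // subsetU // sub_gen ?orbT // subsetUl.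
suff -> : R = P by [].
apply/group_inj/eqP; rewrite eqEcard sRP /=.
rewrite -(leq_pmul2r (cardG_gt0 H)) -(TI_cardMg tiPH) defG.
have := dvdn_cardMg R H; rewrite defRH; apply: dvdn_leq.
by rewrite muln_gt0 !cardG_gt0.
Qed.

End MinimalNonSupersolvable.

(** * Groups whose 2-maximal subgroups are P-subnormal *)

Lemma P_subnormal_quotient (gT : finGroupType) (G K N : {group gT}) :
  G \subset 'N(N) -> P_subnormal K G -> P_subnormal (K / N)%G (G / N)%G.
Proof.
move=> + PK; move: G PK.
apply: P_subnormal_ind => [_ | A B _ IHA sAB prAB nNB].
  exact: P_subnormal_refl.
apply: P_subnormal_trans (IHA (subset_trans sAB nNB)) _.
have iAB : #|B / N : A / N| %| #|B : A|.
  by rewrite index_quotient // subIset ?nNB.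
have [_ iP] := primeP prAB; have /orP[i1 | /eqP i_eq] := iP _ iAB.
  have -> : (B / N)%G = (A / N)%G.
    by apply/group_inj/eqP; rewrite eqEsubset -indexg_eq1 i1 quotientS.
  exact: P_subnormal_refl.
by apply: prime_index_P_subnormal; rewrite ?quotientS ?i_eq.
Qed.

(** At the step A < B of the chain where M is in B but not in A, M :&: A = K,
    and B / gcore A B is supersolvable since |B : A| is prime. So |M : K| is the
    index of a maximal subgroup in a supersolvable section of B. *)
Lemma maximal_P_subnormal_index (gT : finGroupType) (G M K : {group gT}) :
    solvable G -> maximal K M -> M \subset G -> P_subnormal K G ->
  prime #|M : K|.
Proof.
move=> solG maxK sMG PK; have [/andP[sKM not_sMK] _] := maxgroupP maxK.
move: sMG solG; move: G PK.
apply: P_subnormal_ind => [sMK | A B PA IHA sAB prAB sMB solB].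
  by rewrite sMK in not_sMK.
have [sMA | not_sMA] := boolP (M \subset A).
  exact: IHA sMA (solvableS sAB solB).
have maxA : maximal A B := p_index_maximal sAB prAB.
have defK : K = M :&: A :> {set gT}.
  have sKMA : K \subset M :&: A by rewrite subsetI sKM (P_subnormal_sub PA).
  have [defI | defI] := maximal_eq_or maxK sKMA (subsetIl M A).
    by rewrite -[in LHS]defI.
  by case/negP: not_sMA; rewrite -defI subsetIr.
have ssBC := prime_index_quotient_supersolvable solB maxA prAB.
pose C := [group of gcore A B]; have nsCB : C <| B := gcore_normal sAB.
have nCM := subset_trans sMB (normal_norm nsCB).
pose D := (C :&: M)%G; have nsDM : D <| M.
  by rewrite /D /= setIC norm_normalI.
have sDK : D \subset K by rewrite defK subsetI subsetIr subIset ?gcore_sub.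
have nsDK : D <| K := normalS sDK sKM nsDM.
have <- : #|M / D : K / D| = #|M : K|.
  by rewrite index_quotient_eq ?normal_norm // subIset // sDK orbT.
have ssMD : supersolvable (M / D).
  have := second_isog nCM; rewrite isog_sym => /isog_supersolvable; apply.
  exact: supersolvableS (quotientS C sMB) ssBC.
by apply: supersolvable_maximal_index ssMD _; rewrite quotient_maximal.
Qed.

Section TwoMaximal.

Variables (gT : finGroupType) (G : {group gT}).
Hypothesis PsG : forall K : {group gT}, two_maximal K G -> P_subnormal K G.

Lemma maximal2_P_subnormal (M K : {group gT}) :
  maximal M G -> maximal K M -> P_subnormal K G.
Proof. by move=> maxM maxK; apply/PsG/existsP; exists M; rewrite maxK. Qed.

Lemma quotient_two_maximal_P_subnormal (N : {group gT}) : N <| G ->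
  forall K : {group coset_of N}, two_maximal K (G / N) -> P_subnormal K (G / N).
Proof.
move=> nsNG K /existsP[M /andP[maxK maxM]].
have <- : (coset N @*^-1 K / N)%G = K by apply/group_inj/cosetpreK.
apply: P_subnormal_quotient (normal_norm nsNG) _.
apply: (@maximal2_P_subnormal (coset N @*^-1 M)%G).
  by rewrite -(quotientGK nsNG) cosetpre_maximal.
by rewrite cosetpre_maximal.
Qed.

End TwoMaximal.

(** Let P be a Sylow subgroup for the largest prime divisor p of |G|. If P is
    not normal in G, then P is maximal: otherwise a maximal subgroup M above
    'N_G(P) has a maximal subgroup above P, which contains all the conjugates of
    P, and M = G by the Frattini argument. A maximal subgroup K of P is
    normal in G: the chain from K to G ends with a subgroup A of index p, in
    which K is the unique Sylow p-subgroup. If K = 1, then P has order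
    p and is its own normaliser, so that, unless G is abelian, G^`(1) is a
    normal p-complement. A nontrivial Sylow r-subgroup R of G^`(1) is then
    normalised by a conjugate of P, which is a maximal subgroup, and R is normal
    in G. Induction applies to the quotient of G by P, K or R. *)
Lemma two_maximal_P_subnormal_sol (gT : finGroupType) (G : {group gT}) :
    (forall K : {group gT}, two_maximal K G -> P_subnormal K G) ->
  solvable G.
Proof.
have [n] := ubnP #|G|; elim: n => // n IHn in gT G * => /ltnSE-leGn PsG.
have quo (r : nat) (N : {group gT}) :
    N <| G -> N :!=: 1 -> r.-group N -> solvable G.
  move=> nsNG ntN rN; rewrite (series_sol nsNG) (pgroup_sol rN).
  apply: IHn (quotient_two_maximal_P_subnormal PsG nsNG).
  by apply: leq_trans leGn; rewrite ltn_quotient ?normal_sub.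
have [-> | ntG] := eqVneq (G : {set gT}) 1; first exact: solvable1.
pose p := max_pdiv #|G|.
have p_pr : prime p by rewrite max_pdiv_prime ?cardG_gt1.
have le_p : {in \pi(G), forall r, r <= p} := @pi_leq_max_pdiv _ G.
have [P sylP] := Sylow_exists p G; have [sPG pP p'GP] := and3P sylP.
have ntP : P :!=: 1.
  by rewrite -rank_gt0 (rank_Sylow sylP) p_rank_gt0 pi_max_pdiv cardG_gt1.
have [nsPG | not_nsPG] := boolP (P <| G); first exact: quo nsPG ntP pP.
have sPN : P \subset 'N_G(P) by rewrite subsetI sPG normG.
have [defN | [M maxM sNM]] := maximal_exists (subsetIl G 'N(P)).
  by rewrite /normal sPG -{1}defN subsetIr in not_nsPG.
have sMG := proper_sub (maxgroupp maxM).
have not_sPK (K : {group gT}) :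
    K \subset M -> P_subnormal K G -> ~~ (P \subset K).
  move=> sKM PK; apply/negP=> sPK; have := maxgroupp maxM.
  rewrite properE; case/andP=> _ /negP[].
  rewrite (Sylow_sub_Frattini sMG sylP sNM) // => Q sylQ.
  apply: subset_trans sKM.
  exact: (P_subnormal_Sylow_sub p_pr le_p PK sylP sPK sylQ).
have defP : M = P.
  have [/group_inj // | [K maxK sPK]] := maximal_exists (subset_trans sPN sNM).
  have := not_sPK K (proper_sub (maxgroupp maxK)).
  by rewrite sPK => /(_ (maximal2_P_subnormal PsG maxM maxK)).
rewrite {M}defP in maxM sNM sMG not_sPK.
have no_Sylow (A Q : {group gT}) : P_subnormal A G -> A :!=: G ->
    p.-Sylow(G) Q -> Q \subset A -> False.
  move=> PA neAG sylQ sQA.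
  have sPA := P_subnormal_Sylow_sub p_pr le_p PA sylQ sQA sylP.
  have [defA | defA] := maximal_eq_or maxM sPA (P_subnormal_sub PA).
    by move: PA; rewrite defA => /(not_sPK P (subxx P)); rewrite subxx.
  by rewrite defA eqxx in neAG.
have [P1 | [K maxK _]] := maximal_exists (sub1G P).
  by rewrite -P1 eqxx in ntP.
have iKP := p_maximal_index pP maxK; have sKP := proper_sub (maxgroupp maxK).
have nsKP := p_maximal_normal pP maxK; have pK := pgroupS sKP pP.
have PK := maximal2_P_subnormal PsG maxM maxK.
have neKG : K :!=: G.
  apply: contraTneq (maxgroupp maxK) => ->.
  by rewrite properE sPG andbF.
have [A [PKA sAG prGA]] := P_subnormal_last PK neKG.
have sKA := P_subnormal_sub PKA.
have PA := prime_index_P_subnormal sAG prGA.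
have neAG : A :!=: G by apply: contraTneq prGA => ->; rewrite indexgg.
have iGA : #|G : A| = p.
  apply/eqP; apply: contraT => neq_p; have [Q sylQ] := Sylow_exists p A.
  case: (no_Sylow A Q PA neAG _ (pHall_sub sylQ)).
  have [sQA pQ p'AQ] := and3P sylQ; rewrite /pHall (subset_trans sQA) // pQ.
  by rewrite -(Lagrange_index sAG sQA) pnatM p'AQ pnatE ?andbT.
have sylK : p.-Sylow(A) K.
  rewrite /pHall sKA pK; suff -> : #|A : K| = #|G : P| by [].
  apply/eqP; rewrite -(eqn_pmul2l (prime_gt0 p_pr)) -{1}iGA Lagrange_index //.
  by rewrite mulnC -iKP Lagrange_index.
have nKA : A \subset 'N(K).
  apply/subsetP=> a Aa; rewrite inE.
  apply: (P_subnormal_Sylow_sub p_pr _ PKA sylK (subxx K)).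
    by move=> r /(piSg sAG); apply: le_p.
  by rewrite pHallJ.
have nsKG : K <| G.
  rewrite /normal (subset_trans sKP sPG) /=.
  have sPNK : P \subset 'N_G(K) by rewrite subsetI sPG normal_norm.
  have sANK : A \subset 'N_G(K) by rewrite subsetI sAG.
  have [defN | defN] := maximal_eq_or maxM sPNK (subsetIl _ _); last first.
    by rewrite -{1}defN subsetIr.
  have sAP : A \subset P by rewrite -defN.
  have [_ pD] := primeP p_pr; have := indexgS G sAP; rewrite iGA => /pD/orP[].
    rewrite indexg_eq1 => sGP; have := maxgroupp maxM.
    by rewrite properE sGP andbF.
  by move/eqP=> iGP; move: p'GP; rewrite iGP pnatE // !inE eqxx.
have [K1 | ntK] := eqVneq (K : {set gT}) 1; last exact: quo nsKG ntK pK.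
have oP : #|P| = p by rewrite -iKP K1 indexg1.
have defN : 'N_G(P) = P by apply/eqP; rewrite eqEsubset sNM.
(* P has prime order, so g normalises P as soon as x and x ^ g are in P. *)
have tiG'P : G^`(1) :&: P = 1.
  have /derG1P P'1 : abelian P by rewrite cyclic_abelian ?prime_cyclic ?oP.
  apply/trivgP; rewrite /= setIC -P'1.
  apply: transfer_focal sylP _ => x g Px Gg Pxg.
  have [-> | ntx] := eqVneq x 1; first by exists 1; rewrite ?group1 ?conj1g.
  exists g => //; rewrite -defN inE Gg.
  have defx : <[x]> = P.
    have sxP : <[x]> \subset P by rewrite cycle_subG.
    apply/eqP; rewrite eqEsubset sxP prime_meetG ?oP //.
    by rewrite (setIidPr sxP) cycle_eq1.
  by rewrite inE -{1}defx -cycleJ cycle_subG.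
have nsG'G : G^`(1) <| G := der_normal 1 G.
have [sG'P | not_sG'P] := boolP (G^`(1) \subset P).
  by apply/abelian_sol/derG1P/trivgP; rewrite -tiG'P /= subsetIidl.
have defG : G^`(1) * P = G := maximal_normal_mul maxM nsG'G not_sG'P.
have p'G' : p^'.-group G^`(1).
  rewrite /pgroup; suff -> : #|G^`(1)| = #|G : P| by [].
  apply/eqP; rewrite -(eqn_pmul2l (cardG_gt0 P)) Lagrange // mulnC.
  by rewrite -(TI_cardMg tiG'P) /= defG.
have [G'1 | [r r_pr rG']] := trivgVpdiv G^`(1)%G.
  exact/abelian_sol/derG1P.
have [R sylR] := Sylow_exists r G^`(1).
have [sRG' rR _] := and3P sylR.
have ntR : R :!=: 1.
  by rewrite -rank_gt0 (rank_Sylow sylR) p_rank_gt0 mem_primes r_pr cardG_gt0.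
have sRG := subset_trans sRG' (normal_sub nsG'G).
have sRN : R \subset 'N_G(R) by rewrite subsetI sRG normG.
have [Q sylQN] := Sylow_exists p 'N_G(R); have [sQN pQ p'NQ] := and3P sylQN.
have sylQ : p.-Sylow(G) Q.
  rewrite /pHall pQ (subset_trans sQN) ?subsetIl //.
  rewrite -(Lagrange_index (subsetIl G _) sQN) pnatM p'NQ andbT.
  suff -> : #|G : 'N_G(R)| = #|G^`(1) : 'N_G(R)|.
    exact: pnat_dvd (dvdn_indexg _ _) p'G'.
  apply/eqP; rewrite -(eqn_pmul2r (cardG_gt0 'N_G(R))) !LagrangeMr /=.
  have /= -> := Frattini_arg nsG'G sylR.
  by rewrite mulGSid ?subsetIl.
have [x Gx defQ] := Sylow_trans sylP sylQ.
have maxQ : maximal Q G by rewrite defQ -(conjGid Gx) maximalJ.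
have [defNR | defNR] := maximal_eq_or maxQ sQN (subsetIl _ _).
  have pR : p.-group R by apply: pgroupS pQ; rewrite -defNR.
  have coRR := pnat_coprime pR (pgroupS sRG' p'G').
  by rewrite -subG1 -(coprime_TIg coRR) subsetI subxx in ntR.
apply: quo ntR rR; rewrite /normal sRG; apply/setIidPl.
exact: (congr1 (@gval gT) defNR).
Qed.

(** * The characterisation *)

(** Every maximal subgroup of G satisfies the hypotheses of Huppert's
    criterion. *)
Lemma two_maximal_P_subnormal_proper (gT : finGroupType) (G : {group gT}) :
    (forall K : {group gT}, two_maximal K G -> P_subnormal K G) ->
  forall H : {group gT}, H \proper G -> supersolvable H.
Proof.
move=> PsG H ltHG; have solG := two_maximal_P_subnormal_sol PsG.
have [defH | [M maxM sHM]] := maximal_exists (proper_sub ltHG).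
  by rewrite defH properxx in ltHG.
have sMG := proper_sub (maxgroupp maxM).
apply: supersolvableS sHM _; apply: Huppert_supersolvable => [|K maxK].
  exact: solvableS sMG solG.
have PK := maximal2_P_subnormal PsG maxM maxK.
exact: maximal_P_subnormal_index solG maxK sMG PK.
Qed.

(** If M is a maximal subgroup of nonprime index and R is the residual, then
    Phi(R) lies in M. If it is not trivial, a Hall p'-subgroup H of M is proper
    in M. The chain from a maximal subgroup of M above H ends with a subgroup A
    of prime index. It contains R, as G / gcore A G is supersolvable, and H, so
    its index is both prime to p and a power of p. *)
Lemma two_maximal_P_subnormal_Phi (gT : finGroupType) (G : {group gT}) :
    (forall K : {group gT}, two_maximal K G -> P_subnormal K G) ->
  'Phi(supersolvable_residual G) = 1.
Proof.
move=> PsG; have solG := two_maximal_P_subnormal_sol PsG.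
have ssG := two_maximal_P_subnormal_proper PsG.
have [ss | nss] := boolP (supersolvable G).
  by apply/trivgP; rewrite -(supersolvable_residual_eq1 ss) Phi_sub.
have [M maxM nprM] : exists2 M : {group gT}, maximal M G & ~~ prime #|G : M|.
  apply/exists_inP; apply: contraR nss.
  rewrite negb_exists_in => /forall_inP prM.
  by apply: Huppert_supersolvable solG _ => M /prM; rewrite negbK.
have [p p_pr sylR] := residual_Sylow ssG maxM nprM solG.
set R := supersolvable_residual G in sylR *.
have [nsRG ssGR minR] := supersolvable_residual_min G.
have sMG := proper_sub (maxgroupp maxM).
apply/eqP; apply: contraT => ntPhi.
have sPhiM : 'Phi(R) \subset M.
  exact: subset_trans (Phi_normal_sub nsRG) (Phi_sub_max maxM).
have [H hallH] := Hall_exists p^' (solvableS sMG solG).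
have [sHM p'H pMH] := and3P hallH.
have pPhi : p.-group 'Phi(R) := pgroupS (Phi_sub R) (pHall_pgroup sylR).
have [defH | [K maxK sHK]] := maximal_exists sHM.
  have p'Phi : p^'.-group 'Phi(R) by apply: pgroupS p'H; rewrite defH.
  have coPhi := pnat_coprime pPhi p'Phi.
  by rewrite -subG1 -(coprime_TIg coPhi) subsetI subxx in ntPhi.
have PK := maximal2_P_subnormal PsG maxM maxK.
have neKG : K :!=: G.
  apply: contraTneq (maxgroupp maxK) => ->.
  by rewrite properE sMG andbF.
have [A [PKA sAG prGA]] := P_subnormal_last PK neKG.
have maxA := p_index_maximal sAG prGA.
have sRA : R \subset A.
  apply: subset_trans (gcore_sub A G); apply: minR.
    exact: gcore_normal.
  exact: prime_index_quotient_supersolvable.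
have sHA : H \subset A := subset_trans sHK (P_subnormal_sub PKA).
have p'GA : p^'.-nat #|G : A|.
  by apply: pnat_dvd (indexgS G sRA) _; case/and3P: sylR.
have pGM : p.-nat #|G : M|.
  suff -> : #|G : M| = #|R : M|.
    exact: pnat_dvd (dvdn_indexg R M) (pHall_pgroup sylR).
  apply/eqP; rewrite -(eqn_pmul2r (cardG_gt0 M)) !LagrangeMr /=.
  by rewrite (nonprime_residual_mul maxM nprM) mulGSid.
have pGA : p.-nat #|G : A|.
  apply: pnat_dvd (indexgS G sHA) _.
  by rewrite -(Lagrange_index sMG sHM) pnatM pGM -[p.-nat _]pnatNK.
by rewrite (pnat_1 pGA p'GA) in prGA.
Qed.

Theorem mainTheorem1 (gT : finGroupType) (G : {group gT}) :
  (forall K : {group gT}, two_maximal K G -> P_subnormal K G) <->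
  ('Phi(supersolvable_residual G) = 1 /\
   forall H : {group gT}, H \proper G -> supersolvable H).
Proof.
split=> [PsG | [PhiR1 ssG] K /existsP[M /andP[maxK maxM]]].
  split; first exact: two_maximal_P_subnormal_Phi.
  exact: two_maximal_P_subnormal_proper.
have sMG := proper_sub (maxgroupp maxM).
have sKM := proper_sub (maxgroupp maxK).
have sKG := subset_trans sKM sMG.
have ssM := ssG M (maxgroupp maxM).
have prMK := supersolvable_maximal_index ssM maxK.
have PKM := prime_index_P_subnormal sKM prMK.
have [prGM | nprGM] := boolP (prime #|G : M|).
  exact: P_subnormal_trans PKM (prime_index_P_subnormal sMG prGM).
have solG := proper_supersolvable_sol ssG.
have [p p_pr sylR] := residual_Sylow ssG maxM nprGM solG.
have [nsRG _ _] := supersolvable_residual_min G.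
set R := supersolvable_residual G in PhiR1 sylR nsRG.
have [sRG pR p'GR] := and3P sylR.
have abelR : p.-abelem R by rewrite -trivg_Phi // PhiR1.
have abR := abelem_abelian abelR.
have defG : R * M = G := nonprime_residual_mul maxM nprGM.
pose N := (R :&: M)%G.
have sNR : N \subset R := subsetIl R M.
have nsNG : N <| G.
  rewrite /normal (subset_trans sNR sRG) -defG mul_subG //.
    by rewrite cents_norm // (subset_trans abR) ?centS.
  by rewrite normsI ?normG // (subset_trans sMG) ?normal_norm.
(* N lies in the core of M, which is Phi(G), but N is complemented in G. *)
have tiRM : R :&: M = 1.
  have [X /complP[tiNX defNX]] : exists X, X \in [complements to N in G].
    apply/splitsP; rewrite (Gaschutz_split nsNG sNR sRG (abelianS sNR abR)).
      exact: abelem_splits abelR sNR.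
    exact: pnat_coprime (pgroupS sNR pR) p'GR.
  have sNPhi : N \subset 'Phi(G).
    rewrite -(nonprime_gcore_Phi ssG maxM nprGM) sub_gcore ?subsetIr //.
    exact: normal_norm.
  have defX : X :=: G.
    have sXG : X \subset G by rewrite -defNX mulG_subr.
    rewrite -[LHS]genGid; apply: Phi_nongen; apply/eqP.
    rewrite eqEsubset join_subG Phi_sub sXG /= -{1}defNX.
    by rewrite mul_subG ?joing_subr // (subset_trans sNPhi) ?joing_subl.
  by rewrite -[R :&: M]/(gval N) -tiNX defX; apply/esym/setIidPl/normal_sub.
have nRK := subset_trans sKG (normal_norm nsRG).
pose T := (K <*> R)%G; have defT : T = K * R :> {set gT}.
  by rewrite /T /= joingC norm_joinEr // -normC.
have tiKR : K :&: R = 1.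
  by apply/trivgP; rewrite -tiRM subsetI subsetIr subIset ?sKM.
have sTG : T \subset G by rewrite join_subG sKG.
have iGT : #|G : T| = #|M : K|.
  have oT : #|T| = (#|K| * #|R|)%N by rewrite defT TI_cardMg.
  apply/eqP; rewrite -(eqn_pmul2l (cardG_gt0 T)) Lagrange // oT mulnAC.
  by rewrite Lagrange // mulnC -TI_cardMg // defG.
apply: P_subnormal_trans (prime_index_P_subnormal sTG _); last by rewrite iGT.
apply: supersolvable_P_subnormal (joing_subl K R); apply: ssG.
by rewrite properE sTG -indexg_gt1 iGT prime_gt1.
Qed.
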